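(* Let $\mathsf X$ be a general diffusion on a finite metric graph $\Gamma$ with $\mathsf X_0=\mathbf x$, $\mathrm P_{\mathbf x}$-almost surely, let $\Delta=(V_\Delta,E_\Delta)$ be a covering subdivision of $\Gamma$ and let $\widetilde{\mathsf X}^\Delta$ be the STMCA of $\mathsf X$ on $\Delta$. Let $(\tau^\Delta_k)_{k\ge0}$ be the embedding times of $\mathsf X$ into $V_\Delta$: $\tau^\Delta_0=0$, $\tau^\Delta_1=\inf\{t\ge0:\mathsf X_t\in V_\Delta\}$ and $\tau^\Delta_k=\inf\{t\ge\tau^\Delta_{k-1}:\mathsf X_t\in V_\Delta\setminus\{\mathsf X_{\tau^\Delta_{k-1}}\}\}$ for $k\ge2$; and for $t\ge0$ let $$K^\Delta(t)=\inf\Big\{k\in\mathbb N:\ \sum_{n=1}^k\mathrm E\big[\tau^\Delta_n-\tau^\Delta_{n-1}\,\big|\,\sigma(\mathsf X_{\tau^\Delta_{n-1}},\mathsf X_{\tau^\Delta_n})\big]>t\Big\}.$$ Then the process $\big(\mathsf X_{\tau^\Delta_{K^\Delta(t)}}\big)_{t\ge0}$ has the same law as $\widetilde{\mathsf X}^\Delta$.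
   Context: **Finite metric graph.** Let $U_1,\dots,U_N$ be intervals, each of the form $[0,l)$, $[0,l]$ or $[0,\infty)$; put $E=\{1,\dots,N\}$ and let $l_e\in(0,\infty]$ be the length of $U_e$. $\Gamma=(V,E)$ is the quotient of $\bigsqcup_{e}U_e$ by an equivalence relation on the set of endpoints belonging to the intervals; $V$ is the set of classes of endpoints. Points are written $\mathbf x=(e,x)$, $x\in U_e$. $\Gamma$ carries the geodesic distance $d$. An edge $e$ incident to $\mathbf v\in V$ points outwards from $\mathbf v$ if $(e,0)=\mathbf v$ and inwards to $\mathbf v$ if $(e,l_e)=\mathbf v$; $E(\mathbf v)$, $E_{\rm out}(\mathbf v)$, $E_{\rm in}(\mathbf v)$ are the incident, outward and inward edges. **General diffusion.** A regular continuous strong Markov process $\mathsf X=(I,X)$ on $\Gamma$ without killing ($I$ is the edge label, $X$ the coordinate), determined by: for each $e\in E$, a positive locally finite measure $m_e$ on $U_e$ (speed) and a continuous increasing function $s_e$ on $U_e$ (scale), with $\mathrm L_e=\frac12\mathrm D_{m_e}\mathrm D_{s_e}$; for each $\mathbf v\in V$, a number $\rho_{\mathbf v}\ge0$ and numbers $\beta^{\mathbf v}_e>0$, $e\in E(\mathbf v)$, summing to 1. Its generator is $\mathrm Lf(e,x)=\mathrm L_ef(e,x)$ on the set of $f\in C(\Gamma)$ with $\mathrm Lf\in C(\Gamma)$ and, for all $\mathbf v\in V$, $\sum_{j\in E_{\rm out}(\mathbf v)}\beta^{\mathbf v}_jf'(j,0)-\sum_{j\in E_{\rm in}(\mathbf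 v)}\beta^{\mathbf v}_jf'(j,l_j)=\rho_{\mathbf v}\,\mathrm Lf(\mathbf v)$. **Subdivisions.** For $e\in E(\mathbf v)$, $(\hat s^{\mathbf v}_e,\hat m^{\mathbf v}_e)$ is $(s_e,m_e)$ if $(e,0)=\mathbf v$, and the pair reversed by $y\mapsto l_e-y$ if $(e,l_e)=\mathbf v$; $\hat s^{\mathbf v}_e((0,u))$ denotes the length (absolute increment) of the scale over $(0,u)$. A subdivision $\Delta=(V_\Delta,E_\Delta)$ of $\Gamma$ is obtained by adding vertices to $V$ and splitting the edges accordingly. A cell of $\Delta$ is an open set $U\subset\Gamma$ with $\partial U\subset V_\Delta$ containing exactly one element of $V_\Delta$, its center; $\mathcal C(\Delta)$ is the set of cells. For a vertex neighborhood $U=\bigcup_{e\in E(\mathbf v)}\{(e,x): d(\mathbf v,(e,x))<u_e\}$, $u_e<l_e$: $|U|_{\mathsf X}=\rho_{\mathbf v}\sum_{e\in E(\mathbf v)}\hat s^{\mathbf v}_e((0,u_e))/\beta^{\mathbf v}_e+\sum_{e\in E(\mathbf v)}\hat m^{\mathbf v}_e((0,u_e))\,\hat s^{\mathbf v}_e((0,u_e))$. For an edge-segment $U=\{(e,x):x\in(a,b)\}$: $|U|_{\mathsf X}=m_e((a,b))\,|s_e(b)-s_e(a)|$. $\Delta$ is covering if $|\Delta|_{\mathsf X}=\sup_{U\in\mathcal C(\Delta)}|U|_{\mathsf X}<\infty$. **STMCA.** For $\mathbf y\in\Gamma$ let $T_{\mathbf y}$ be the hitting time of $\mathbf y$ by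 $\mathsf X$, and for a cell $U$ let $T_U$ be the exit time of $\mathsf X$ from $U$. For $\mathbf x\in V_\Delta$ let $U_{\mathbf x}$ be the cell centered at $\mathbf x$, and put $\mathfrak p_{\mathbf x,\mathbf y}=\mathrm P_{\mathbf x}(T_{U_{\mathbf x}}=T_{\mathbf y})$, $\mathfrak t_{\mathbf x,\mathbf y}=\mathrm E_{\mathbf x}(T_{U_{\mathbf x}}\mid T_{U_{\mathbf x}}=T_{\mathbf y})$. If the starting point $\mathbf x$ of $\mathsf X$ is in $V_\Delta$, let $\mu_0=\delta_{\mathbf x}$; otherwise $\mu_0(\mathbf y)=\mathrm P_{\mathbf x}(\mathsf X_{T_U}=\mathbf y)$, $\mathbf y\in V_\Delta$, where $U$ is any (arbitrarily chosen) cell containing $\mathbf x$. The STMCA of $\mathsf X$ on $\Delta$ is $\widetilde{\mathsf X}^\Delta_t=\sum_{k\ge1}\mathsf Y_k\mathbf 1_{t\in[T_{k-1},T_k)}$, where $(\mathsf Y_k)_{k\ge0}$ is a Markov chain on $V_\Delta$ with $\mathsf Y_0\sim\mu_0$ and transition probabilities $(\mathfrak p_{\mathbf x,\mathbf y})$, $T_0=0$ and $T_k-T_{k-1}=\mathfrak t_{\mathsf Y_{k-1},\mathsf Y_k}$.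
   Formalization: The starting point x is assumed to lie in V_Δ; for x outside V_Δ the claim fails (reflected Brownian motion on [0,1], V_Δ={0,1/2,1}, x=1/4: the embedded process starts uniformly on {0,1/2}, while the STMCA starts at Y_1, which has a different law for every choice of cell). *)

(* Defs.v *)
From HB Require Import structures.
From mathcomp Require Import all_boot all_order all_algebra generic_quotient.
From mathcomp Require Import all_classical all_reals all_analysis.
From mathcomp Require Import measurable_realfun.

Set Implicit Arguments.
Unset Strict Implicit.
Unset Printing Implicit Defensive.

Import Order.TTheory GRing.Theory Num.Theory.
Import numFieldNormedType.Exports.

Local Open Scope quotient_scope.
Local Open Scope classical_set_scope.
Local Open Scope ring_scope.
Local Open Scope ereal_scope.

(* The edges are 'I_nedge.+1.  The three shapes [0,l), [0,l], [0,oo) of U_e are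
   encoded by [len e : \bar R] and by the flag [closed_end e] telling whether
   the far end l_e belongs to U_e.  The pair (e, false) is the endpoint 0 of
   U_e and (e, true) its endpoint l_e; [glue] is only ever consulted on the
   pairs (e, true) with [closed_end e] and on the pairs (e, false). *)
Record metric_graph (R : realType) := MetricGraph {
  nedge : nat ;
  len : 'I_nedge.+1 -> \bar R ;
  closed_end : 'I_nedge.+1 -> bool ;
  glue : rel ('I_nedge.+1 * bool) ;
  len_gt0 : forall e, 0 < len e ;
  closed_len_lty : forall e, closed_end e -> len e < +oo ;
  glue_equiv : equivalence_rel glue }.

Section graph_points.
Context {R : realType} (G : metric_graph R).

Definition edge : Type := 'I_(nedge G).+1.

Definition in_edge (e : edge) (x : R) : bool :=
  (0 <= x)%R && (if closed_end e then x%:E <= len e else x%:E < len e).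

Definition edge_coord : Type := {q : edge * R | in_edge q.1 q.2}.

Definition endpoint_of (q : edge_coord) : option (edge * bool) :=
  if (val q).2 == 0%R then Some ((val q).1, false)
  else if ((val q).2)%:E == len (val q).1 then Some ((val q).1, true)
  else None.

Definition same_point (q1 q2 : edge_coord) : bool :=
  (q1 == q2) ||
  match endpoint_of q1, endpoint_of q2 with
  | Some a, Some b => glue a b
  | _, _ => false
  end.

Let glueR : reflexive (@glue R G).
Proof. by move=> a; have [] := glue_equiv a a a. Qed.

Let glueS : symmetric (@glue R G).
Proof.
move=> a b; apply/idP/idP => h.
  by have [_ /(_ h)] := glue_equiv a b a; rewrite glueR => <-.
by have [_ /(_ h)] := glue_equiv b a b; rewrite glueR => <-.
Qed.

Let glueT : transitive (@glue R G).
Proof. by move=> b a c hab; have [_ /(_ hab) ->] := glue_equiv a b c. Qed.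

Lemma same_point_refl : reflexive same_point.
Proof. by move=> q; rewrite /same_point eqxx. Qed.

Lemma same_point_sym : symmetric same_point.
Proof.
move=> q1 q2; rewrite /same_point eq_sym; congr orb.
by case: endpoint_of => [a|]; case: endpoint_of => [b|] //; rewrite glueS.
Qed.

Lemma same_point_trans : transitive same_point.
Proof.
move=> q2 q1 q3 /orP[/eqP -> //|h12] /orP[/eqP <-|h23].
  by rewrite /same_point h12 orbT.
rewrite /same_point; apply/orP; right; move: h12 h23.
case: (endpoint_of q1) => [a|//]; case: (endpoint_of q2) => [b|//].
by case: (endpoint_of q3) => [c|//]; exact: glueT.
Qed.

Canonical same_point_equiv :=
  EquivRel same_point same_point_refl same_point_sym same_point_trans.

Definition gpoint : Type := {eq_quot same_point_equiv}.

HB.instance Definition _ := Choice.on gpoint.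

Lemma in_edge0 (e : edge) : in_edge e 0%R.
Proof. by rewrite /in_edge lexx/= len_gt0 (ltW (len_gt0 e)); case: ifP. Qed.

(* The point (e, x); outside U_e the value is the junk (e, 0). *)
Definition pt (e : edge) (x : R) : gpoint :=
  \pi_({eq_quot same_point_equiv})
    (insubd (exist (fun q : edge * R => in_edge q.1 q.2) (e, 0%R) (in_edge0 e))
            (e, x)).

HB.instance Definition _ := isPointed.Build gpoint (pt ord0 0%R).

(* [path_len p q r]: a path from p to q consisting of finitely many pieces,
   each of them contained in one edge, has length r. *)
Inductive path_len (p : gpoint) : gpoint -> R -> Prop :=
| path_len_nil : path_len p p 0%R
| path_len_step e x y r : in_edge e x -> in_edge e y ->
    path_len p (pt e x) r -> path_len p (pt e y) (r + `|x - y|)%R.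

Definition gdist (p q : gpoint) : \bar R :=
  ereal_inf [set r%:E | r in path_len p q].

Lemma path_len_trans p q r a b :
  path_len p q a -> path_len q r b -> path_len p r (a + b)%R.
Proof.
move=> hpq hqr; elim: hqr => [|e x y s ex ey _ ih]; first by rewrite addr0.
by rewrite addrA; exact: path_len_step.
Qed.

Lemma path_len_sym p q a : path_len p q a -> path_len q p a.
Proof.
elim=> [|e x y r ex ey _ ih]; first exact: path_len_nil.
rewrite addrC; apply: path_len_trans ih.
rewrite distrC -[X in path_len _ _ X]add0r.
by apply: path_len_step => //; exact: path_len_nil.
Qed.

Lemma gdist_ltP p q (e : R) :
  gdist p q < e%:E <-> exists2 r, (r < e)%R & path_len p q r.
Proof.
split=> [/ereal_inf_lt[_ [r pr <-]]|[r re pr]].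
  by rewrite lte_fin => re; exists r.
by apply: (@le_lt_trans _ _ r%:E) => //; apply: ereal_inf_lbound; exists r.
Qed.

Definition gball (p : gpoint) (e : R) : set gpoint :=
  [set q | gdist p q < e%:E].

Definition gent : set_system (gpoint * gpoint) := entourage_ gball.

HB.instance Definition _ := hasNbhs.Build gpoint (nbhs_ gent).

Lemma gball_center p (e : R) : (0 < e)%R -> gball p e p.
Proof. by move=> e0; apply/gdist_ltP; exists 0%R => //; exact: path_len_nil. Qed.

Lemma gball_sym p q (e : R) : gball p e q -> gball q e p.
Proof.
by move=> /gdist_ltP[r re /path_len_sym pr]; apply/gdist_ltP; exists r.
Qed.

Lemma gball_triangle p q r (e1 e2 : R) :
  gball p e1 q -> gball q e2 r -> gball p (e1 + e2)%R r.
Proof.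
move=> /gdist_ltP[a ae pa] /gdist_ltP[b be pb].
by apply/gdist_ltP; exists (a + b)%R; [exact: ltrD|exact: path_len_trans pb].
Qed.

HB.instance Definition _ := @Nbhs_isPseudoMetric.Build R gpoint gent erefl
  gball gball_center gball_sym gball_triangle erefl.

Definition borel : Type := g_sigma_algebraType (@open gpoint).

HB.instance Definition _ := Measurable.on borel.

(* [at_end v (e, b)]: v is the endpoint 0 of e if b = false, and e is outward
   at v; v is the endpoint l_e of e if b = true, and e is inward at v. *)
Definition at_end (v : gpoint) (h : edge * bool) : bool :=
  if h.2 then closed_end h.1 && (v == pt h.1 (fine (len h.1)))
  else v == pt h.1 0%R.

Definition out_edge (v : gpoint) : pred edge := fun e => at_end v (e, false).
Definition inw_edge (v : gpoint) : pred edge := fun e => at_end v (e, true).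
Definition inc_edge (v : gpoint) : pred edge :=
  fun e => out_edge v e || inw_edge v e.

Definition vertex : set gpoint := [set v | exists h, at_end v h].

End graph_points.

(* The speed measure of e is only ever used on subsets of U_e, and the scale
   function of e only on U_e. *)
Record diffusion_data (R : realType) (G : metric_graph R) := DiffusionData {
  speed : edge G -> {measure set (measurableTypeR R) -> \bar R} ;
  scale : edge G -> R -> R ;
  rho : gpoint G -> R ;
  beta : gpoint G -> edge G -> R ;
  speed_lty : forall e c, in_edge e c -> speed e [set` `[0%R, c]] < +oo ;
  speed_gt0 : forall e a b, in_edge e a -> in_edge e b -> (a < b)%R ->
    0 < speed e [set` `]a, b[] ;
  scale_continuous : forall e, {within [set x | in_edge e x], continuous (scale e)} ;
  scale_increasing : forall e a b, in_edge e a -> in_edge e b -> (a < b)%R ->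
    (scale e a < scale e b)%R ;
  rho_ge0 : forall v, vertex v -> (0 <= rho v)%R ;
  beta_gt0 : forall v e, vertex v -> inc_edge v e -> (0 < beta v e)%R ;
  beta_sum1 : forall v, vertex v -> (\sum_(e | inc_edge v e) beta v e)%R = 1%R }.

Section generator.
Context {R : realType} {G : metric_graph R} (D : diffusion_data G).
Implicit Types (f g : gpoint G -> R) (e : edge G).

(* C(Gamma): the semigroup acts on bounded continuous functions. *)
Definition bounded_continuous f : Prop :=
  continuous f /\ exists M : R, forall p, (`|f p| <= M)%R.

Definition right_scale_derivative f e (x h : R) : Prop :=
  ((f (pt e y) - f (pt e x)) / (scale D e y - scale D e x))%R @[y --> x^'+] --> h.

Definition left_scale_derivative f e (x h : R) : Prop :=
  ((f (pt e y) - f (pt e x)) / (scale D e y - scale D e x))%R @[y --> x^'-] --> h.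

(* g = (1/2) D_m D_s f in the interior of e, where D_s is the right derivative
   with respect to the scale, and g = (1/2) D_m h means
   h b - h a = 2 \int_(]a, b]) g dm. *)
Definition edge_operator f g e : Prop :=
  exists Df : R -> R,
    (forall x : R, (0 < x)%R -> x%:E < len e -> right_scale_derivative f e x (Df x)) /\
    (forall a b : R, (0 < a)%R -> (a < b)%R -> b%:E < len e ->
      (Df b - Df a)%R%:E = \int[speed D e]_(x in `]a, b]) (2 * g (pt e x))%R%:E).

(* f belongs to the domain of L and L f = g; derivatives at the vertices are
   one-sided derivatives with respect to the scale. *)
Definition in_generator f g : Prop :=
  [/\ bounded_continuous f, bounded_continuous g,
      forall e, edge_operator f g e &
      exists df0 dfl : edge G -> R,
        [/\ forall e, right_scale_derivative f e 0%R (df0 e),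
            forall e, closed_end e ->
              left_scale_derivative f e (fine (len e)) (dfl e) &
            forall v, vertex v ->
              (\sum_(e | out_edge v e) beta D v e * df0 e
               - \sum_(e | inw_edge v e) beta D v e * dfl e = rho D v * g v)%R]].

End generator.

Section processes.
Context {R : realType} {G : metric_graph R} {d : measure_display}
  {Omega : measurableType d}.
Implicit Types (P : gpoint G -> probability Omega R) (X : R -> Omega -> gpoint G)
  (F : R -> set (set Omega)) (s : Omega -> \bar R).

(* Processes are indexed by the whole of R, but only the times t >= 0 matter. *)
Definition cylinder X (n : nat) (t : 'I_n -> R) (B : 'I_n -> set (borel G)) :
    set Omega :=
  [set w | forall i, B i (X (t i) w)].

Definition filtration F : Prop :=
  [/\ forall t, (0 <= t)%R -> sigma_algebra setT (F t),
      forall t, (0 <= t)%R -> F t `<=` measurable &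
      forall t u, (0 <= t)%R -> (t <= u)%R -> F t `<=` F u].

Definition adapted F X : Prop :=
  forall t (B : set (borel G)), (0 <= t)%R -> measurable B -> F t (X t @^-1` B).

Definition stopping_time F s : Prop :=
  (forall w, 0 <= s w) /\
  forall t, (0 <= t)%R -> F t [set w | s w <= t%:E].

Definition stopped_events F s : set (set Omega) :=
  [set A | measurable A /\
           forall t, (0 <= t)%R -> F t (A `&` [set w | s w <= t%:E])].

Definition markov_kernel P X : Prop :=
  forall n (t : 'I_n -> R) (B : 'I_n -> set (borel G)),
    (forall i, 0 <= t i)%R -> (forall i, measurable (B i)) ->
    measurable_fun setT (fun p : borel G => P p (cylinder X t B)).

Definition strong_markov F P X : Prop :=
  forall (p : gpoint G) s A, stopping_time F s -> stopped_events F s A ->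
  forall n (t : 'I_n -> R) (B : 'I_n -> set (borel G)),
    (forall i, 0 <= t i)%R -> (forall i, measurable (B i)) ->
    P p [set w | [/\ A w, s w < +oo &
                     forall i, B i (X (fine (s w) + t i)%R w)]]
    = \int[P p]_(w in A `&` [set w | s w < +oo])
        P (X (fine (s w)) w) (cylinder X t B).

Definition first_time X (A : set (gpoint G)) (s : \bar R) (w : Omega) : \bar R :=
  ereal_inf [set t%:E | t in [set t | (0 <= t)%R /\ s <= t%:E /\ A (X t w)]].

Definition hitting_time X (p : gpoint G) : Omega -> \bar R :=
  first_time X [set p] 0.

Definition exit_time X (U : set (gpoint G)) : Omega -> \bar R :=
  first_time X (~` U) 0.

(* X at a random time; the value at +oo is junk. *)
Definition at_time X s (w : Omega) : gpoint G := X (fine (s w)) w.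

Definition semigroup P X (t : R) (f : gpoint G -> R) (p : gpoint G) : R :=
  fine 'E_(P p)[fun w => f (X t w)].

(* The infinitesimal generator, in the sense of bounded pointwise convergence
   of (P_t f - f) / t (Dynkin's weak generator): on a noncompact graph the
   semigroup need not be strongly continuous on bounded continuous functions. *)
Definition generator P X (f g : gpoint G -> R) : Prop :=
  [/\ bounded_continuous f, bounded_continuous g,
      exists M : R, forall t p, (0 < t)%R ->
        (`|(semigroup P X t f p - f p) / t| <= M)%R &
      forall p, ((semigroup P X t f p - f p) / t)%R @[t --> 0^'+] --> g p].

Record general_diffusion (D : diffusion_data G) F P X : Prop := {
  diffusion_filtration : filtration F ;
  diffusion_adapted : adapted F X ;
  diffusion_continuous : forall w,
    {within [set t | 0 <= t]%R, continuous (fun t => X t w)} ;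
  diffusion_start : forall p, P p [set w | X 0%R w = p] = 1 ;
  diffusion_kernel : markov_kernel P X ;
  diffusion_strong_markov : strong_markov F P X ;
  diffusion_regular : forall p q, 0 < P p [set w | hitting_time X q w < +oo] ;
  diffusion_generator : forall f g, generator P X f g <-> in_generator D f g }.

(* C is any version; Z is meant to be nonnegative, possibly infinite, hence the
   absence of an integrability requirement. *)
Definition cond_expectation (Q : probability Omega R) (S : set (set Omega))
    (Z C : Omega -> \bar R) : Prop :=
  (forall B : set (\bar R), measurable B -> S (C @^-1` B)) /\
  forall A, S A -> \int[Q]_(w in A) C w = \int[Q]_(w in A) Z w.

End processes.

Section subdivisions.
Context {R : realType} {G : metric_graph R}.
Implicit Types (VD U : set (gpoint G)) (v : gpoint G) (h : edge G * bool).

(* A subdivision is given by its set of vertices; it may be infinite, but only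
   finitely many vertices lie in a compact part of an edge. *)
Definition subdivision VD : Prop :=
  (@vertex R G `<=` VD) /\
  forall (e : edge G) (c : R), in_edge e c ->
    finite_set [set x : R | (0 <= x <= c)%R /\ VD (pt e x)].

(* Connectedness makes the cell centered at v unique: without it one could add
   to it open segments lying between other vertices. *)
Definition cell VD U v : Prop :=
  [/\ open U, connected U, closure U `\` interior U `<=` VD &
      U `&` VD = [set v]].

(* Distance to the end h measured along the edge: when two edges share both
   ends, gdist may be smaller because of the detour through the other edge. *)
Definition along h (x : R) : R :=
  if h.2 then (fine (len h.1) - x)%R else x.

(* The open segment (0, u) of the edge h.1 read from its end h. *)
Definition end_segment h (u : \bar R) : set (measurableTypeR R) :=
  [set x | in_edge h.1 x /\ (0 < along h x)%R /\ (along h x)%:E < u].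

Definition vertex_neighborhood v (u : edge G * bool -> \bar R) :
    set (gpoint G) :=
  [set p | exists h x, [/\ at_end v h, in_edge h.1 x,
                          (along h x)%:E < u h & p = pt h.1 x]].

Variable D : diffusion_data G.

Definition scale_length (e : edge G) (J : set R) : \bar R :=
  ereal_sup [set z | exists x y : R, [/\ J x, J y & z = (scale D e y - scale D e x)%:E]].

(* In both sums h ranges over the ends of edges located at v, that is over
   E_out(v) and E_in(v). *)
Definition vertex_size v (u : edge G * bool -> \bar R) : \bar R :=
  (rho D v)%:E *
    (\sum_(h | at_end v h)
       scale_length h.1 (end_segment h (u h)) * ((beta D v h.1)^-1)%:E)
  + \sum_(h | at_end v h)
       speed D h.1 (end_segment h (u h)) * scale_length h.1 (end_segment h (u h)).

Definition segment (a : R) (b : \bar R) : set (measurableTypeR R) :=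
  [set x | (a < x)%R /\ x%:E < b].

(* |U|_X = r.  In a cell, u h (resp. b) may be equal to the length of the edge,
   which may be infinite. *)
Definition set_size U (r : \bar R) : Prop :=
  (exists v u,
    [/\ vertex v, forall h, at_end v h -> 0 < u h <= len h.1,
        U = vertex_neighborhood v u & r = vertex_size v u]) \/
  (exists (e : edge G) (a : R) (b : \bar R),
    [/\ (0 <= a)%R, a%:E < b <= len e, U = pt e @` segment a b &
        r = speed D e (segment a b) * scale_length e (segment a b)]).

Definition mesh VD : \bar R :=
  ereal_sup [set r | exists U v, cell VD U v /\ set_size U r].

Definition covering VD : Prop := mesh VD < +oo.

End subdivisions.

Section stmca.
Context {R : realType} {G : metric_graph R} {d : measure_display}
  {Omega : measurableType d}.
Variables (P : gpoint G -> probability Omega R) (X : R -> Omega -> gpoint G)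
  (VD : set (gpoint G)) (U : gpoint G -> set (gpoint G)).

Definition cells_of : Prop := forall x, VD x -> cell VD (U x) x.

(* T_U = T_y as times, that is, both finite. *)
Definition exit_at (x y : gpoint G) : set Omega :=
  [set w | exit_time X (U x) w = hitting_time X y w /\
           exit_time X (U x) w < +oo].

Definition transition_prob (x y : gpoint G) : \bar R := P x (exit_at x y).

(* E_x(T | A) = E_x(T 1_A) / P_x(A) (and 0 if P_x(A) = 0, in which case the
   value is irrelevant). *)
Definition transition_time (x y : gpoint G) : \bar R :=
  (\int[P x]_(w in exit_at x y) exit_time X (U x) w)
  * ((fine (transition_prob x y))^-1)%:E.

Definition initial_law (x : gpoint G) (mu0 : gpoint G -> \bar R) : Prop :=
  (VD x -> forall y, mu0 y = (y == x)%:R%:E) /\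
  (~ VD x -> exists W v, [/\ cell VD W v, W x &
     forall y, VD y -> mu0 y =
       P x [set w | exit_time X W w < +oo /\ at_time X (exit_time X W) w = y]]).

Section chain.
Context {d' : measure_display} {Omega' : measurableType d'}.
Variables (Q : probability Omega' R) (Y : nat -> Omega' -> gpoint G).

Definition stmca_chain (x : gpoint G) : Prop :=
  [/\ forall k, measurable_fun [set: Omega'] (Y k : Omega' -> borel G),
      forall k w, VD (Y k w),
      exists2 mu0, initial_law x mu0 &
        forall y, VD y -> Q [set w | Y 0%N w = y] = mu0 y &
      forall (y : nat -> gpoint G) (k : nat), (forall i, VD (y i)) ->
        Q [set w | forall i, (i <= k.+1)%N -> Y i w = y i]
        = Q [set w | forall i, (i <= k)%N -> Y i w = y i]
          * transition_prob (y k) (y k.+1)].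

Definition jump_time (k : nat) (w : Omega') : \bar R :=
  \sum_(0 <= i < k) transition_time (Y i w) (Y i.+1 w).

(* Y_k on [T_(k-1), T_k), k >= 1.  The value is z after sup_k T_k, if this
   supremum is finite. *)
Definition stmca (z : gpoint G) (t : R) (w : Omega') : gpoint G :=
  xget z [set y | exists k, jump_time k w <= t%:E < jump_time k.+1 w /\
                            y = Y k.+1 w].

End chain.

Fixpoint embedding_time (k : nat) (w : Omega) : \bar R :=
  match k with
  | 0%N => 0
  | k'.+1 =>
      if k' == 0%N then first_time X VD 0 w
      else first_time X (VD `\ at_time X (embedding_time k') w)
             (embedding_time k' w) w
  end.

Definition embedded (k : nat) : Omega -> borel G := at_time X (embedding_time k).

(* inf {k : sum_(n = 1)^k C_n > t}; None stands for +oo. *)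
Definition embedding_index (C : nat -> Omega -> \bar R) (t : R) (w : Omega) :
    option nat :=
  xget None [set o | exists k, [/\ o = Some k,
    t%:E < \sum_(1 <= n < k.+1) C n w &
    forall j, t%:E < \sum_(1 <= n < j.+1) C n w -> (k <= j)%N]].

(* The value is z when the index is infinite. *)
Definition embedded_process (z : gpoint G) (C : nat -> Omega -> \bar R)
    (t : R) (w : Omega) : gpoint G :=
  if embedding_index C t w is Some k then embedded k w else z.

End stmca.

(* Finite-dimensional distributions determine the law on the product
   sigma-algebra indexed by [0, oo). *)
Definition same_law (R : realType) (G : metric_graph R)
    (d1 d2 : measure_display) (O1 : measurableType d1) (O2 : measurableType d2)
    (P1 : probability O1 R) (Z1 : R -> O1 -> gpoint G)
    (P2 : probability O2 R) (Z2 : R -> O2 -> gpoint G) : Prop :=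
  [/\ forall t, (0 <= t)%R -> measurable_fun [set: O1] (Z1 t : O1 -> borel G),
      forall t, (0 <= t)%R -> measurable_fun [set: O2] (Z2 t : O2 -> borel G) &
      forall n (t : 'I_n -> R) (B : 'I_n -> set (borel G)),
        (forall i, 0 <= t i)%R -> (forall i, measurable (B i)) ->
        P1 (cylinder Z1 t B) = P2 (cylinder Z2 t B)].

(* Main.v *)
(* By continuity of the paths, the exit time from the cell [U y] started at its
   centre [y] is the first time in [VD `\ y], so that the successive positions of
   [X] in [VD] are governed, through the strong Markov property at the embedding
   times, by the transition probabilities and times of the STMCA.  The strong
   Markov property is given for cylinders only; it extends to exit times and exit
   points because both sides define finite measures on the space of continuous
   paths which agree on a pi-system generating its sigma-algebra.  The existence
   of the chain [Y] forces the exit times along it to be finite, hence the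
   embedding times are almost surely finite and [X] at the embedding times has
   the law of [Y].  Finally [E [tau_(n+1) - tau_n | X_tau_n, X_tau_(n+1)]] is
   constant on the atoms of a sigma-algebra generated by two discrete variables,
   and its value there is the transition time.  Both processes are thus one and
   the same functional of two chains with the same law, shifted by one index
   because [tau_1 = 0]. *)

Require Import Defs.
From HB Require Import structures.
From mathcomp Require Import all_boot all_order all_algebra generic_quotient.
From mathcomp Require Import all_classical all_reals all_analysis.
From mathcomp Require Import measurable_realfun.
From mathcomp Require Import lra.

Set Implicit Arguments.
Unset Strict Implicit.
Unset Printing Implicit Defensive.

Import Order.TTheory GRing.Theory Num.Theory.
Import numFieldNormedType.Exports.

Local Open Scope classical_set_scope.
Local Open Scope ring_scope.
Local Open Scope ereal_scope.

(** * Subsets of a subdivision *)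

Section graph_topology.
Context {R : realType} (G : metric_graph R).
Local Open Scope quotient_scope.

Lemma pt_surj (p : gpoint G) : exists e x, in_edge e x /\ p = pt e x.
Proof.
elim/quotP: p => q _; case: q => [[e x] exq].
exists e, x; split=> //; rewrite /pt; congr (\pi_ _ _).
by rewrite /insubd insubT.
Qed.

Lemma endpoint_of_vertex (q : edge_coord G) h : endpoint_of q = Some h ->
  vertex (pt (val q).1 (val q).2) /\
  ((val q).2 = 0%R \/ ((val q).2)%:E = len (val q).1).
Proof.
case: q => [[e x] /= ex]; rewrite /endpoint_of/=.
case: eqP => [-> _|x0].
  by split; [exists (e, false); rewrite /at_end/=|left].
case: eqP => // xl _; split; last by right.
exists (e, true); rewrite /at_end/= -xl/= eqxx andbT.
by move: ex; rewrite /in_edge -xl ltxx; case: ifP => //; rewrite andbF.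
Qed.

(** Gluing concerns endpoints only, so a point with two different coordinates is a vertex, read at
    an end of each edge. *)
Lemma pt_eqP (e e' : edge G) x y : in_edge e x -> in_edge e' y ->
  pt e x = pt e' y -> (e = e' /\ x = y) \/
  [/\ vertex (pt e x), x = 0%R \/ x%:E = len e & y = 0%R \/ y%:E = len e'].
Proof.
move=> ex ey /eqquotP.
rewrite /insubd !insubT/= /same_point => /orP[/eqP[-> ->]|]; first by left.
case hx : endpoint_of => [a|//]; case hy : endpoint_of => [b|//] _.
right; have [vx ?] := endpoint_of_vertex hx; have [_ ?] := endpoint_of_vertex hy.
split; assumption.
Qed.

Variables (VD : set (gpoint G)) (hVD : subdivision VD).

Let vertexVD v : vertex v -> VD v. Proof. by move=> ?; apply hVD.1. Qed.

(** Take [c] slightly beyond [x], or [x] itself at the far end. The points of [VD] in [0, c] other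
    than [x] are finitely many, so they form a closed set that misses a ball around [x]. The form
    with [near] lets radii on several edges be combined. *)
Lemma edge_isolated (e : edge G) x : in_edge e x ->
  \forall r \near 0^'+, forall y, in_edge e y -> (`|x - y| < r)%R ->
     y = x \/ ~ VD (pt e y).
Proof.
move=> ex.
have [c [ec dc]] : exists c, in_edge e c /\
    \forall r \near 0^'+, forall y, in_edge e y -> (`|x - y| < r)%R -> (y <= c)%R.
  have [xl|xl] := ltP x%:E (len e).
    have [c /andP[xc cl]] : exists c : R, (x < c)%R && (c%:E < len e).
      move: xl; case: (len e) => [l| |//].
      - by rewrite lte_fin => /midf_lt[? ?]; exists ((x + l) / 2)%R; apply/andP.
      - by move=> _; exists (x + 1)%R; rewrite ltrDl ltr01 ltry.
    exists c; split.
      rewrite /in_edge (ltW cl) cl if_same andbT.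
      by move: ex => /andP[x0 _]; exact: le_trans (ltW xc).
    near=> r => y _ xyr.
    have : (r < c - x)%R by near: r; apply: nbhs_right_lt; rewrite subr_gt0.
    by move: xyr; rewrite ltr_norml => /andP[]; lra.
  exists x; split => //; near=> r => y ey _.
  rewrite -lee_fin; apply: le_trans xl.
  by move: ey => /andP[_]; case: ifP => // _ /ltW.
pose S := [set y | (0 <= y <= c)%R /\ VD (pt e y)] `\ x.
have clS : closed S.
  apply: (accessible_finite_set_closed.1 _ S).
    by apply: hausdorff_accessible; exact: Rhausdorff.
  apply: sub_finite_set (hVD.2 e c ec); exact: subDsetl.
have : nbhs x (~` S).
  by apply: open_nbhs_nbhs; split; [exact: closed_openC|move=> []/= _].
move=> /nbhs_ballP[r0 /= r00 hr0].
near=> r => y ey xyr.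
have yc : (y <= c)%R by move: y ey xyr; near: r; exact: dc.
have xy : ball x r0 y.
  by apply: lt_trans xyr _; near: r; exact: nbhs_right_lt.
have := hr0 _ xy; rewrite /S/= => /not_andP[|/contrapT]; last by left.
move=> h; right => vy; apply: h; split => //.
by rewrite yc andbT; case/andP: ey.
Unshelve. all: by end_near. Qed.

(** The coordinate of [p] on an edge [e] can only be [x0], 0 or [len e]. Three candidates on each of
    finitely many edges admit a common radius. *)
Lemma graph_isolated (p : gpoint G) : exists2 r : R, (0 < r)%R &
  forall e x y, in_edge e x -> in_edge e y -> pt e x = p -> (`|x - y| < r)%R ->
    pt e y = p \/ ~ VD (pt e y).
Proof.
have [e0 [x0 [ex0 ->]]] := pt_surj p.
have near_at e x : \forall r \near (0:R)^'+, forall y, in_edge e x ->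
    in_edge e y -> (`|x - y| < r)%R -> y = x \/ ~ VD (pt e y).
  have [ex|nex] := boolP (in_edge e x); last by apply: nearW.
  by apply: filterS (edge_isolated ex) => r hr y _; exact: hr.
have nearr : \forall r \near (0:R)^'+, forall e (i : 'I_3) y,
    let x := nth 0%R [:: x0; 0%R; fine (len e)] i in in_edge e x ->
    in_edge e y -> (`|x - y| < r)%R -> y = x \/ ~ VD (pt e y).
  by apply: filter_forall => e; apply: filter_forall => i; exact: near_at.
near (0:R)^'+ => r; exists r => // e x y ex ey epx xyr.
have hr : forall e (i : 'I_3) y,
    let x := nth 0%R [:: x0; 0%R; fine (len e)] i in in_edge e x ->
    in_edge e y -> (`|x - y| < r)%R -> y = x \/ ~ VD (pt e y) by near: r.
have key i : (i < 3)%N -> x = nth 0%R [:: x0; 0%R; fine (len e)] i ->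
    pt e y = pt e0 x0 \/ ~ VD (pt e y).
  move=> i3 xE; have := hr e (Ordinal i3) y; rewrite /= -xE => /(_ ex ey xyr).
  by move=> [->|]; [left|right].
have [[_ xx0]|[_ [x00|xl] _]] := pt_eqP ex ex0 epx.
- exact: (key 0%N).
- exact: (key 1%N).
- by apply: (key 2%N) => //=; rewrite -xl.
Unshelve. all: by end_near. Qed.

(** Near [p] the only possible point of [VD] is [p] itself, so a point adherent to [A] belongs to
    [A]. *)
Lemma subset_subdivision_closed A : A `<=` VD -> closed A.
Proof.
move=> AVD p clAp; have [r r0 hr] := graph_isolated p.
have [e0 [x0 [ex0 pE]]] := pt_surj p.
(* A path shorter than [r] stays on the edges at [p]: it can change edges only at a vertex, and the
   only vertex within reach is [p], from which the next piece is measured afresh. *)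
have star q a : path_len p q a -> (a < r)%R ->
    exists e x y, [/\ in_edge e x, in_edge e y, pt e x = p, pt e y = q &
      (`|x - y| <= a)%R].
  elim=> [_|e x y a' ex ey _ ih].
    by exists e0, x0, x0; rewrite subrr normr0.
  move=> ar; have a'r : (a' < r)%R by apply: le_lt_trans ar; rewrite lerDl.
  have [e' [x' [y' [ex' ey' px' py' xya']]]] := ih a'r.
  have [[ee' yx]|[vy _ _]] := pt_eqP ey' ex py'.
    rewrite ee' in ex' ey' px' py' *.
    exists e, x', y; split => //; apply: le_trans (ler_distD x _ _) _.
    by rewrite lerD2r -yx.
  have [pE'|] := hr _ _ _ ex' ey' px' (le_lt_trans xya' a'r); last first.
    by move=> /(_ (vertexVD vy)).
  exists e, x, y; split => //; first by rewrite -py'.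
  by rewrite lerDr; apply: le_trans xya'.
have /clAp[q [Aq /gdist_ltP[a ar pqa]]] : nbhs p (gball p r).
  by apply/nbhs_ballP; exists r.
have [e [x [y [ex ey px qE xya]]]] := star _ _ pqa ar; rewrite -qE in Aq.
have Vq := AVD _ Aq; move: Aq.
by have [->|/(_ Vq)] := hr _ _ _ ex ey px (le_lt_trans xya ar).
Qed.

Lemma subdivision_countable : countable VD.
Proof.
(* Each edge is exhausted by the segments [0, c] with [c] rational, together with the one ending at
   [len e], coded by [None]; each of them carries finitely many points of [VD]. *)
pose cE (e : edge G) (q : option rat) : R :=
  if q is Some q' then ratr q' else fine (len e).
pose S (e : edge G) (q : option rat) :=
  [set x : R | (0 <= x <= cE e q)%R /\ VD (pt e x)].
have Sfin e q : countable (if in_edge e (cE e q) then S e q else set0).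
  by case: ifPn => // h; apply: finite_set_countable; apply: hVD.2.
apply: (@sub_countable _ _ VD (\bigcup_(e in [set: edge G])
  \bigcup_(q in [set: option rat])
  (pt e @` (if in_edge e (cE e q) then S e q else set0)))).
  apply: subset_card_le => p Vp; have [e [x [ex pE]]] := pt_surj p.
  exists e => //.
  have [xl|xl] := ltP x%:E (len e).
    have [q /andP[xq ql]] : exists q : rat, (x < ratr q)%R && ((ratr q : R)%:E < len e).
      move: xl; case: (len e) => [l| |//].
      - rewrite lte_fin => /rat_in_itvoo[q]; rewrite in_itv/= => /andP[? ?].
        by exists q; apply/andP.
      - move=> _; have /rat_in_itvoo[q] : (x < x + 1)%R by rewrite ltrDl.
        by rewrite in_itv/= => /andP[xq _]; exists q; rewrite xq ltry.
    exists (Some q) => //; exists x => //; rewrite ifT.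
      by split; rewrite -?pE //= (ltW xq) andbT; case/andP: ex.
    rewrite /in_edge/= (ltW ql) ql if_same andbT.
    by case/andP: ex => x0 _; exact: le_trans (ltW xq).
  have xE : x = fine (len e).
    have : x%:E <= len e by case/andP: ex => _; case: ifP => // _ /ltW.
    by move=> h; have /eqP <- : x%:E == len e by rewrite eq_le h.
  exists None => //; exists x => //; rewrite ifT /= -?xE//.
  by split; rewrite -?pE// xE lexx andbT -xE; case/andP: ex.
apply: bigcup_countable => [|e _]; first exact: countableP.
apply: bigcup_countable => [|q _]; first exact: countableP.
exact: (sub_countable (card_image_le _ _)).
Qed.

(** Replaces vertices by integer codes. The code [f] is made constant off [VD] so that its level
    sets are Borel; [v] supplies the default values. *)
Lemma subdivision_enum v : VD v ->
  exists (g : nat -> gpoint G) (f : gpoint G -> nat),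
  [/\ forall m, VD (g m), forall y, VD y -> g (f y) = y &
      forall y, ~ VD y -> f y = f v].
Proof.
move=> Vv; have /countable_injP[f fI] := subdivision_countable.
exists (fun m => xget v [set y | VD y /\ f y = m]).
exists (fun y => if pselect (VD y) is left _ then f y else f v); split.
- by move=> m; case: xgetP => [y _ []|].
- move=> y Vy; case: pselect => // _; case: xgetP => [y' _ [Vy' e]|/(_ y)[]//].
  by apply: fI; rewrite ?inE.
- by move=> y; case: pselect => // _ _; case: pselect.
Qed.

End graph_topology.

(** * Hitting times of continuous paths *)

Section hitting.
Context {R : realType} {G : metric_graph R}.
Implicit Types (f : R -> gpoint G) (A : set (gpoint G)) (s : \bar R).

Definition continuous_path f := {within [set t | 0 <= t]%R, continuous f}.

(** [first_time] of a single path, detached from the sample space so that it also applies to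
    elements of path space. *)
Definition hit f A s : \bar R :=
  ereal_inf [set t%:E | t in [set t | (0 <= t)%R /\ s <= t%:E /\ A (f t)]].

Lemma continuous_pathP f t V : continuous_path f -> (0 <= t)%R ->
  nbhs (f t) V ->
  exists2 e : R, (0 < e)%R & forall u, (0 <= u)%R -> (`|t - u| < e)%R -> V (f u).
Proof.
move=> /subspace_continuousP/(_ t) /[apply] cf /cf.
by rewrite /= => /nbhs_ballP[e /= e0 he]; exists e => // u u0 /he; apply.
Qed.

Lemma hit_ge f A s : s <= hit f A s.
Proof. by apply: le_ereal_inf_tmp => _ [t [_ [st _]] <-]. Qed.

Lemma hit_ge0 f A s : 0 <= hit f A s.
Proof. by apply: le_ereal_inf_tmp => _ [t [t0 [st _]] <-]; rewrite lee_fin. Qed.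

Lemma hit_le f A s t : (0 <= t)%R -> s <= t%:E -> A (f t) -> hit f A s <= t%:E.
Proof. by move=> t0 st At; apply: ereal_inf_lbound; exists t. Qed.

Lemma hit_attained f A s : continuous_path f -> closed A -> hit f A s < +oo ->
  exists t, [/\ hit f A s = t%:E, (0 <= t)%R & A (f t)].
Proof.
move=> cf clA hoo.
have hfin : hit f A s \is a fin_num.
  by rewrite ge0_fin_numE// hit_ge0.
have h0 : (0 <= fine (hit f A s))%R by rewrite fine_ge0// hit_ge0.
exists (fine (hit f A s)); split; rewrite ?fineK//.
apply: clA => V /(continuous_pathP cf h0)[e e0 he].
have /ereal_inf_lt[_ [t [t0 [st At]] <-]] : hit f A s < (fine (hit f A s) + e)%:E.
  by rewrite EFinD fineK// lteDl// lte_fin.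
rewrite lte_fin => te; exists (f t); split => //; apply: he => //.
have : (fine (hit f A s) <= t)%R.
  by rewrite -lee_fin fineK//; exact: hit_le.
move=> ht; rewrite distrC ger0_norm ?subr_ge0//; lra.
Qed.

(* As [q] varies, the rationals of [0, t] together with [t] itself. *)
Definition clamp (t : R) (q : rat) : R :=
  Num.min (Num.max 0%R (ratr q)) t.

Lemma clamp_itv t q : (0 <= t)%R -> (0 <= clamp t q <= t)%R.
Proof. by move=> t0; rewrite /clamp le_min le_max lexx t0 ge_min lexx orbT. Qed.

Lemma clamp_dense t a e : (0 <= a <= t)%R -> (0 < e)%R ->
  exists q, (a <= clamp t q < a + e)%R.
Proof.
move=> /andP[a0 +] e0; rewrite le_eqVlt => /predU1P[<-|at_].
  have /rat_in_itvoo[q] : (a < a + 1)%R by rewrite ltrDl.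
  rewrite in_itv/= => /andP[aq _]; exists q.
  have -> : clamp a q = a by apply/min_r; rewrite le_max (ltW aq) orbT.
  by rewrite lexx ltrDl.
have /rat_in_itvoo[q] : (a < Num.min (a + e) t)%R by rewrite lt_min ltrDl e0.
rewrite in_itv/= => /andP[aq]; rewrite lt_min => /andP[qe qt]; exists q.
have -> : clamp t q = ratr q.
  rewrite /clamp max_r; last by rewrite (le_trans a0)// ltW.
  by rewrite min_l// ltW.
by rewrite (ltW aq).
Qed.

(** Open neighbourhoods of [A] that shrink to its closure. *)
Definition thicken A (n : nat) : set (gpoint G) :=
  \bigcup_(a in A) (ball a n.+1%:R^-1)^°.

Lemma open_thicken A n : open (thicken A n).
Proof. by apply: bigcup_open => a _; exact: open_interior. Qed.

Lemma sub_thicken A n : A `<=` thicken A n.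
Proof.
move=> a Aa; exists a => //; apply: nbhsx_ballx.
by rewrite invr_gt0.
Qed.

(** Describes the hitting event through countably many times. A path that meets [A] visits each open
    [thicken A n] at a time [clamp t q] just after the meeting; the converse rests on
    compactness. *)
Lemma hit_leP f A s t : continuous_path f -> closed A -> 0 <= s -> (0 <= t)%R ->
  hit f A s <= t%:E <->
  s <= t%:E /\ forall n, exists q, s <= (clamp t q)%:E /\ thicken A n (f (clamp t q)).
Proof.
move=> cf clA s0 t0; split=> [ht|[st hn]].
  split; first exact: le_trans (hit_ge _ _ _) ht.
  have [v [hv v0 Av]] := hit_attained cf clA (le_lt_trans ht (ltry _)).
  have sv : s <= v%:E by rewrite -hv; exact: hit_ge.
  move=> n; have /(continuous_pathP cf v0)[e e0 he] : nbhs (f v) (thicken A n).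
    by apply: open_nbhs_nbhs; split; [exact: open_thicken|exact: sub_thicken].
  have vt : (0 <= v <= t)%R by rewrite v0 -lee_fin -hv.
  have [q /andP[vq qe]] := clamp_dense vt e0.
  exists q; split; first by apply: le_trans sv _; rewrite lee_fin.
  apply: he; first by case/andP: (clamp_itv q t0).
  by rewrite distrC ger0_norm ?subr_ge0//; lra.
rewrite leNgt; apply/negP => th.
have [r sE] : exists r, s = r%:E.
  by exists (fine s); rewrite fineK// ge0_fin_numE//; exact: le_lt_trans st (ltry _).
rewrite sE !lee_fin in s0 st hn *.
(* A path avoiding [A] on [r, t] keeps away from [A] near each of these times; compactness of [r, t]
   makes one [n] serve all of them. *)
have : \forall n \near \oo, `[r, t] `<=` [set v | (r <= v)%R -> ~ thicken A n (f v)].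
  have /compact_near_coveringP := @segment_compact R r t; apply => v.
  rewrite /= in_itv/= => /andP[rv vt].
  have v0 : (0 <= v)%R by exact: le_trans rv.
  have nAv : ~ A (f v).
    move=> Av; move: th; rewrite ltNge => /negP; apply.
    by apply: le_trans (hit_le v0 _ Av) _; rewrite ?sE lee_fin.
  have : nbhs (f v) (~` A) by apply: open_nbhs_nbhs; split => //; exact: closed_openC.
  move=> /nbhs_ballP[e /= e0 he].
  have e20 : (0 < e / 2)%R by rewrite divr_gt0.
  have /(continuous_pathP cf v0)[e' e'0 he'] : nbhs (f v) (ball (f v) (e / 2)).
    exact: nbhsx_ballx.
  exists (ball v e', [set n | (n.+1%:R^-1 < e / 2)%R]).
    split=> /=; first exact: nbhsx_ballx.
    by apply: near_infty_natSinv_lt (PosNum e20).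
  move=> [v' n]/= [vv' ne] rv' [a Aa /interior_subset av'].
  apply: (he a) => //; rewrite [e]splitr.
  apply: (ball_triangle (he' _ (le_trans s0 rv') vv')).
    by apply/ball_sym; apply: le_ball av'; exact: ltW.
move=> [n _ /(_ n (leqnn n))] hn'.
have [q [rq hq]] := hn n.
rewrite lee_fin in rq; apply: (hn' (clamp t q)) => //=.
by rewrite in_itv/= rq; case/andP: (clamp_itv q t0).
Qed.

End hitting.

(** * Stopping times *)

Lemma g_sigma_of_sigma_algebra (T : pointedType) (S : set (set T)) A :
  sigma_algebra setT S -> measurable (A : set (g_sigma_algebraType S)) <-> S A.
Proof. by move=> /measurable_g_measurableTypeE SE; rewrite -[in X in _ <-> X]SE. Qed.

Lemma closed_borel (R : realType) (G : metric_graph R) (A : set (gpoint G)) :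
  closed A -> measurable (A : set (borel G)).
Proof.
move=> cA; rewrite -[A]setCK; apply: measurableC.
by apply: sub_sigma_algebra; exact: closed_openC.
Qed.

Section stopping.
Context {R : realType} {d : measure_display} {Omega : measurableType d}.
Variables (F : R -> set (set Omega)) (hF : filtration F).
Implicit Types (s S : Omega -> \bar R) (t : R).

(** Turns [F t] into the sigma-algebra of a measurable type, so that the closure properties of
    [measurable] apply to it. *)
Let Ft t := g_sigma_algebraType (F t).

Lemma filtrationP t A : (0 <= t)%R -> measurable (A : set (Ft t)) <-> F t A.
Proof. by case: hF => sF _ _ t0; exact: (g_sigma_of_sigma_algebra A (sF t t0)). Qed.

Lemma filtration_le t u A : (0 <= t)%R -> (t <= u)%R -> F t A ->
  measurable (A : set (Ft u)).
Proof.
case: hF => _ _ iF t0 tu FA; apply/filtrationP; first exact: le_trans tu.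
exact: iF FA.
Qed.

Lemma stopping_time_measurable s : stopping_time F s -> measurable_fun setT s.
Proof.
case: hF => _ mF _ [s0 hs].
apply: (measurability _ (ErealGenOInfty.measurableE R)).
move=> _ [_ [r ->] <-]; rewrite setTI.
have [r0|r0] := leP 0%R r.
  rewrite (_ : _ @^-1` _ = ~` [set w | s w <= r%:E]).
    by apply: measurableC; apply: (mF r) => //; exact: hs.
  by apply/seteqP; split => w /=; rewrite in_itv/= andbT ltNge => /negP.
rewrite (_ : _ @^-1` _ = setT) //; apply/seteqP; split => w //= _.
by rewrite in_itv/= andbT; apply: lt_le_trans (s0 w); rewrite lte_fin.
Qed.

(** When [s <= t], the failure [s < S] means that [s <= clamp t q < S] for some [q]: countably many
    events, all of them known at time [t]. *)
Lemma stopping_le s S t : stopping_time F s -> stopping_time F S -> (0 <= t)%R ->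
  F t [set w | s w <= t%:E /\ S w <= s w].
Proof.
move=> [s0 hs] [S0 hS] t0; apply/filtrationP => //.
have c0 q : (0 <= clamp t q)%R by case/andP: (clamp_itv q t0).
have ct q : (clamp t q <= t)%R by case/andP: (clamp_itv q t0).
rewrite (_ : mkset _ = [set w | s w <= t%:E] `&`
   ~` (\bigcup_q ([set w | s w <= (clamp t q)%:E] `\` [set w | S w <= (clamp t q)%:E]))).
  apply: measurableI; first by apply/filtrationP => //; exact: hs.
  apply: measurableC; apply: bigcupT_measurable_rat => q.
  by apply: measurableD; apply: filtration_le (ct q) _ => //; [exact: hs|exact: hS].
apply/seteqP; split => w [/= st Ss]; split => //.
  by move=> [q _ []/= sq]; apply; exact: le_trans sq.
rewrite leNgt; apply/negP => sS; apply: Ss.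
have [r sE] : exists r, s w = r%:E.
  by exists (fine (s w)); rewrite fineK// ge0_fin_numE//; exact: le_lt_trans st (ltry _).
have [e e0 re] : exists2 e : R, (0 < e)%R & (r + e)%:E <= S w.
  move: sS; rewrite sE; case: (S w) => [v| |//].
    by rewrite lte_fin => rv; exists (v - r)%R; rewrite ?subr_gt0// addrC subrK.
  by move=> _; exists 1%R => //; rewrite leey.
have rt : (0 <= r <= t)%R by rewrite -!lee_fin -sE s0.
have [q /andP[rq qr]] := clamp_dense rt e0.
exists q => //; split => /=; first by rewrite sE lee_fin.
by apply/negP; rewrite -ltNge; apply: lt_le_trans re; rewrite lte_fin.
Qed.

Lemma stopped_events_le s S A : stopping_time F s -> stopping_time F S ->
  (forall w, s w <= S w) -> stopped_events F s A -> stopped_events F S A.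
Proof.
move=> _ [_ hS] sS [mA hA]; split => // t t0; apply/filtrationP => //.
rewrite (_ : _ `&` _ = (A `&` [set w | s w <= t%:E]) `&` [set w | S w <= t%:E]).
  by apply: measurableI; apply/filtrationP => //; [exact: hA|exact: hS].
rewrite -setIA; congr (_ `&` _); apply/seteqP; split => w /= => [St|[]//].
by split => //; exact: le_trans St.
Qed.

Lemma stopped_eventsI s A B : stopped_events F s A -> stopped_events F s B ->
  stopped_events F s (A `&` B).
Proof.
move=> [mA hA] [mB hB]; split; first exact: measurableI.
move=> t t0; apply/filtrationP => //; rewrite -[X in _ `&` X]setIid setIACA.
by apply: measurableI; apply/filtrationP => //; [exact: hA|exact: hB].
Qed.

Context {G : metric_graph R}.
Variables (X : R -> Omega -> gpoint G) (aX : adapted F X).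
Hypothesis cX : forall w, continuous_path (X^~ w).
Implicit Types A : set (gpoint G).

(** [hit_leP] expresses the event through the positions at the times [clamp t q], none of which
    exceeds [t]. *)
Lemma first_time_stopping s A : stopping_time F s -> closed A ->
  stopping_time F (fun w => first_time X A (s w) w).
Proof.
move=> [s0 hs] cA; split=> [w|t t0]; first exact: (hit_ge0 (X^~ w)).
have c0 q : (0 <= clamp t q)%R by case/andP: (clamp_itv q t0).
have ct q : (clamp t q <= t)%R by case/andP: (clamp_itv q t0).
apply/filtrationP => //.
rewrite (_ : mkset _ = [set w | s w <= t%:E] `&` \bigcap_n \bigcup_q
   ([set w | s w <= (clamp t q)%:E] `&` (X (clamp t q) @^-1` thicken A n))).
  apply: measurableI; first by apply/filtrationP => //; exact: hs.
  apply: bigcapT_measurable => n; apply: bigcupT_measurable_rat => q.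
  apply: measurableI; apply: filtration_le (ct q) _ => //; first exact: hs.
  by apply: aX => //; apply: sub_sigma_algebra; exact: open_thicken.
apply/seteqP; split => w /=.
  move=> /(hit_leP (@cX w) cA (s0 w) t0)[st h]; split => // n _.
  by have [q [? ?]] := h n; exists q.
move=> [st h]; apply/(hit_leP (@cX w) cA (s0 w) t0); split => // n.
by have [q _ [? ?]] := h n Logic.I; exists q.
Qed.

(** Turns a condition on the position at time [s] into a comparison of two stopping times, to which
    [stopping_le] applies. *)
Lemma at_time_hit s A w : closed A -> 0 <= s w -> s w < +oo ->
  A (at_time X s w) <-> first_time X A (s w) w <= s w.
Proof.
move=> cA s0 soo; have sE : s w = (fine (s w))%:E by rewrite fineK// ge0_fin_numE.
have fs0 : (0 <= fine (s w))%R by rewrite fine_ge0.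
split=> [Aw|hs].
  by rewrite [leRHS]sE; apply: (@hit_le _ _ (X^~ w)); rewrite // -sE.
have [v [hv v0 Av]] := hit_attained (@cX w) cA (le_lt_trans hs soo).
suff vs : v = fine (s w) by rewrite /at_time -vs.
apply/eqP; rewrite eq_le -!lee_fin -sE -hv hs.
exact: (hit_ge (X^~ w)).
Qed.

Lemma at_time_stopped s A : stopping_time F s -> closed A ->
  stopped_events F s [set w | s w < +oo /\ A (at_time X s w)].
Proof.
move=> ss cA; have [s0 hs] := ss.
have key t : (0 <= t)%R ->
    F t ([set w | s w < +oo /\ A (at_time X s w)] `&` [set w | s w <= t%:E]).
  move=> t0; have := stopping_le ss (first_time_stopping ss cA) t0.
  congr F; apply/seteqP; split => w /=.
    by move=> [st h]; have soo := le_lt_trans st (ltry _); split => //; split => //;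
      apply/at_time_hit.
  by move=> [[soo Aw] st]; split => //; apply/at_time_hit.
split=> //; have [_ mF _] := hF.
rewrite (_ : mkset _ = \bigcup_n ([set w | s w < +oo /\ A (at_time X s w)] `&`
   [set w | s w <= (n%:R)%:E])).
  by apply: bigcupT_measurable => n; apply: (mF n%:R) => //; exact: key.
apply/seteqP; split => [w [soo Aw]|w [n _ []//]].
exists (Num.Def.trunc (fine (s w))).+1 => //; split => //=.
rewrite -[leLHS]fineK ?ge0_fin_numE// lee_fin ltW//.
exact: truncnS_gt.
Qed.

Lemma first_time_measurable s A : stopping_time F s -> closed A ->
  measurable_fun setT (fun w => first_time X A (s w) w).
Proof. by move=> ss cA; apply: stopping_time_measurable; exact: first_time_stopping. Qed.

End stopping.

(** * Positions at measurable random times *)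

Section measurable_times.
Context {R : realType} {d : measure_display} {Omega : measurableType d}
  {G : metric_graph R}.
Implicit Types s : Omega -> \bar R.

(** For this constant filtration every nonnegative measurable time is a stopping time, so the
    results on stopping times also give plain measurability. *)
Lemma filtration_measurable : filtration (fun _ : R => @measurable d Omega).
Proof.
split=> [t _|t _|t u _ _] //.
exact: sigma_algebra_measurable.
Qed.

Lemma measurable_stopping_time s : (forall w, 0 <= s w) -> measurable_fun setT s ->
  stopping_time (fun _ : R => @measurable d Omega) s.
Proof.
move=> s0 ms; split => // t t0; rewrite -[X in measurable X]setTI.
exact: emeasurable_fun_infty_c.
Qed.

Variables (X : R -> Omega -> gpoint G).
Hypothesis cX : forall w, continuous_path (X^~ w).
Hypothesis mX : forall t, (0 <= t)%R -> measurable_fun setT (X t : Omega -> borel G).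

Lemma at_time_measurable s : (forall w, 0 <= s w) -> measurable_fun setT s ->
  measurable_fun setT (at_time X s : Omega -> borel G).
Proof.
move=> s0 ms; apply: measurability => // _ [B oB <-]; rewrite setTI.
have aX : adapted (fun _ : R => @measurable d Omega) X.
  by move=> t C t0 mC; rewrite -[X in measurable X]setTI; exact: mX.
(* [at_time] reads only [fine (s w)], so [s] may be replaced by this finite time. *)
pose s' w := (fine (s w))%:E.
have ms' : measurable_fun setT s'.
  by apply/measurable_EFinP; apply: measurableT_comp ms; exact: fine_measurable.
have s'0 w : 0 <= s' w by rewrite lee_fin fine_ge0.
have cB : closed (~` B) by exact: open_closedC.
have [+ _] := at_time_stopped filtration_measurable aX (@cX)
  (measurable_stopping_time s'0 ms') cB.
move/measurableC; congr measurable; apply/seteqP; split => w /=.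
  move=> /not_andP[|/contrapT //]; by rewrite ltry.
by move=> Bw [_]; apply.
Qed.

End measurable_times.

(** * Path space *)

Section transfer.
Context {R : realType} {d1 d2 d3 : measure_display} {T1 : measurableType d1}
  {T2 : measurableType d2} {W : measurableType d3}.
Variables (m1 : {measure set T1 -> \bar R}) (m2 : {measure set T2 -> \bar R}).
Variables (f1 : T1 -> W) (f2 : T2 -> W) (k : {nonneg R}) (A : set T1).
Hypotheses (mf1 : measurable_fun setT f1) (mf2 : measurable_fun setT f2).
Hypotheses (mA : measurable A) (Aoo : m1 A < +oo).
Variable S : set (set W).
Hypotheses (mS : measurable = <<s S >>) (SI : setI_closed S) (ST : S setT).
Hypothesis m12 : forall E, S E -> m1 (A `&` f1 @^-1` E) = k%:num%:E * m2 (f2 @^-1` E).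

(** As functions of [E], both sides are finite measures that agree on the generating pi-system [S],
    which contains the whole space. *)
Lemma transfer_measure E : measurable E ->
  m1 (A `&` f1 @^-1` E) = k%:num%:E * m2 (f2 @^-1` E).
Proof.
move=> mE; rewrite setIC.
change (pushforward (mrestr m1 mA) f1 E = pushforward (mscale k m2) f2 E).
apply: (@measure_unique _ _ _ S (fun=> setT)) mE => //.
- by apply/seteqP; split => // w _; exists 0%N.
- by move=> B SB; rewrite /= /pushforward /= /mrestr setIC m12.
- by move=> _; rewrite /= /pushforward/= /mrestr preimage_setT setTI.
Qed.

Lemma transfer_integral E (h : W -> \bar R) : measurable E ->
  measurable_fun setT h -> (forall w, 0 <= h w) ->
  \int[m1]_(x in A `&` f1 @^-1` E) h (f1 x) =
  k%:num%:E * \int[m2]_(x in f2 @^-1` E) h (f2 x).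
Proof.
move=> mE mh h0.
have mE1 : measurable (f1 @^-1` E) by rewrite -[X in measurable X]setTI; exact: mf1.
have mE2 : measurable (f2 @^-1` E) by rewrite -[X in measurable X]setTI; exact: mf2.
have mhf1 : measurable_fun setT (h \o f1) by apply: measurableT_comp.
have mhf2 : measurable_fun setT (h \o f2) by apply: measurableT_comp.
(* Restricting [m1] to [A] and scaling [m2] by [k] reduces the claim to the equality of two
   push-forward measures on [W]. *)
transitivity (\int[mrestr m1 mA]_(x in f1 @^-1` E) h (f1 x)).
  rewrite (@ge0_negligible_integral _ _ _ (mrestr m1 mA) (f1 @^-1` E) (~` A)) //.
  - rewrite setDE setCK setIC; apply: eq_measure_integral => B mB BA.
    by rewrite /= /mrestr setIidl// => w /BA[].
  - exact: measurableC.
  - exact: measurable_funS mhf1.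
  - by rewrite /= /mrestr setICl measure0.
transitivity (\int[mscale k m2]_(x in f2 @^-1` E) h (f2 x)).
  rewrite -[LHS](ge0_integral_pushforward mf1)//; last exact: measurable_funS mh.
  rewrite -[RHS](ge0_integral_pushforward mf2)//; last exact: measurable_funS mh.
  apply: eq_measure_integral => B mB _.
  have := transfer_measure mB; rewrite setIC.
  by [].
rewrite ge0_integral_mscale//; exact: measurable_funS mhf2.
Qed.

End transfer.

Section path_space.
Context {R : realType} (G : metric_graph R).

(** The paths are functions on all of [R], continuous on the half-line. The cylinders below look
    only at times [t >= 0], so values at negative times are invisible. *)
Definition continuous_paths : Type := {f : R -> gpoint G | continuous_path f}.

HB.instance Definition _ := gen_eqMixin continuous_paths.
HB.instance Definition _ := gen_choiceMixin continuous_paths.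

Lemma continuous_path_cst (p : gpoint G) : continuous_path (fun _ : R => p).
Proof. by apply/subspace_continuousP => t _; exact: cvg_cst. Qed.

HB.instance Definition _ := isPointed.Build continuous_paths
  (exist _ _ (@continuous_path_cst point)).

Definition path_cylinder n (t : 'I_n -> R) (B : 'I_n -> set (borel G)) :
    set continuous_paths := [set f | forall i, B i (sval f (t i))].

Definition path_cylinders : set (set continuous_paths) :=
  [set E | exists n t B, [/\ (forall i : 'I_n, 0 <= t i)%R,
     forall i, measurable (B i) & E = path_cylinder t B]].

Definition path_space : Type := g_sigma_algebraType path_cylinders.

HB.instance Definition _ := Measurable.on path_space.

Definition coord (t : R) (f : path_space) : gpoint G := sval f t.

Lemma path_cylindersI : setI_closed path_cylinders.
Proof.
move=> _ _ [n1 [t1 [B1 [t10 mB1 ->]]]] [n2 [t2 [B2 [t20 mB2 ->]]]].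
exists (n1 + n2)%N.
exists (fun i : 'I_(n1 + n2) =>
  match fintype.split i with inl j => t1 j | inr j => t2 j end).
exists (fun i : 'I_(n1 + n2) =>
  match fintype.split i with inl j => B1 j | inr j => B2 j end).
split => [i|i|]; try by case: (fintype.split i).
apply/seteqP; split => f.
  by move=> [h1 h2] i /=; case: (fintype.split i) => j; [exact: h1|exact: h2].
move=> h; split => i.
  by have := h (lshift n2 i); rewrite (unsplitK (inl i)).
by have := h (rshift n1 i); rewrite (unsplitK (inr i)).
Qed.

Lemma path_cylindersT : path_cylinders setT.
Proof.
exists 0%N, (fun _ => 0%R), (fun _ => setT); split => [[]//|[]//|].
by apply/seteqP; split => // f _ [].
Qed.

Lemma coord_measurable t : (0 <= t)%R ->
  measurable_fun setT (coord t : path_space -> borel G).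
Proof.
move=> t0 _ B mB; rewrite setTI; apply: sub_sigma_algebra.
exists 1%N, (fun _ => t), (fun _ => B); split => //.
by apply/seteqP; split => f /= => [? _|/(_ ord0)].
Qed.

Lemma coord_continuous f : continuous_path (coord^~ f).
Proof. by case: f. Qed.

Lemma path_map_measurable d (Omega : measurableType d) (h : Omega -> path_space) :
  (forall t, 0 <= t -> measurable_fun setT (fun w => coord t (h w) : borel G))%R ->
  measurable_fun setT h.
Proof.
move=> mh; apply: measurability => // _ [_ [n [t [B [t0 mB ->]]]] <-].
rewrite setTI (_ : _ @^-1` _ =
    \bigcap_(i : 'I_n) (fun w => coord (t i) (h w)) @^-1` (B i)).
  apply: fin_bigcap_measurable => // i _; rewrite -[X in measurable X]setTI; exact: mh.
by apply/seteqP; split => w /= hw i; [move=> _; exact: hw|exact: hw].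
Qed.

End path_space.

(** * Strong Markov property on path space *)

Section strong_markov_paths.
Context {R : realType} {G : metric_graph R} {d : measure_display}
  {Omega : measurableType d}.
Variables (D : diffusion_data G) (F : R -> set (set Omega))
  (P : gpoint G -> probability Omega R) (X : R -> Omega -> gpoint G).
Hypothesis hX : general_diffusion D F P X.
Implicit Types s : Omega -> \bar R.

Lemma diffusion_path w : continuous_path (X^~ w).
Proof. exact: diffusion_continuous hX w. Qed.

Lemma diffusion_measurable t : (0 <= t)%R ->
  measurable_fun setT (X t : Omega -> borel G).
Proof.
move=> t0 _ B mB; rewrite setTI.
have [_ mF _] := diffusion_filtration hX; apply: (mF t) => //.
exact: (diffusion_adapted hX t0 mB).
Qed.

Lemma continuous_path_shift (r : R) w : (0 <= r)%R ->
  continuous_path (fun t => X (r + t)%R w).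
Proof.
move=> r0; apply/subspace_continuousP => t t0 V nV.
have rt0 : (0 <= r + t)%R by rewrite addr_ge0.
have [e e0 he] := continuous_pathP (@diffusion_path w) rt0 nV.
rewrite /= nbhs_simpl/=; apply/nbhs_ballP; exists e => // u/= tu u0; apply: he.
  by rewrite addr_ge0.
by rewrite opprD addrACA subrr add0r.
Qed.

Lemma fine_time_ge0 s : (forall w, 0 <= s w) -> forall w, (0 <= fine (s w))%R.
Proof. by move=> s0 w; exact: fine_ge0. Qed.

(* Where [s = +oo] this is the whole path, since [fine +oo = 0]. *)
Definition path_after s (s0 : forall w, 0 <= s w) (w : Omega) : path_space G :=
  exist _ _ (@continuous_path_shift _ w (fine_time_ge0 s0 w)).

Definition path_from0 : Omega -> path_space G :=
  @path_after (cst 0) (fun=> lexx 0).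

Lemma path_after_measurable s (s0 : forall w, 0 <= s w) :
  measurable_fun setT s -> measurable_fun setT (path_after s0).
Proof.
move=> ms; apply: path_map_measurable => t t0.
have s'0 w : 0 <= (fine (s w) + t)%:E.
  by rewrite lee_fin addr_ge0// fine_ge0.
apply: (at_time_measurable diffusion_path diffusion_measurable s'0).
apply/measurable_EFinP; apply: measurable_funD => //.
by apply: measurableT_comp ms; exact: fine_measurable.
Qed.

Lemma path_from0_measurable : measurable_fun setT path_from0.
Proof. by apply: path_after_measurable; exact: measurable_cst. Qed.

Section restart.
Variables (p y : gpoint G) (s : Omega -> \bar R) (A : set Omega).
Hypotheses (s0 : forall w, 0 <= s w) (ss : stopping_time F s) (sA : stopped_events F s A).
Hypothesis Ay : forall w, A w -> s w < +oo /\ at_time X s w = y.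

Let ms := stopping_time_measurable (diffusion_filtration hX) ss.

Let PA0 : (0 <= fine (P p A))%R. Proof. by rewrite fine_ge0. Qed.
Let k : {nonneg R} := NngNum PA0.

Let mA : measurable A. Proof. by case: sA. Qed.

Let kE : k%:num%:E = P p A.
Proof. by rewrite /= fineK// fin_num_measure. Qed.

(** On [A] the process sits at [y] at the finite time [s], so the integrand in the strong Markov
    property is constant. *)
Let cylinders_eq E : path_cylinders E ->
  P p (A `&` path_after s0 @^-1` E) = k%:num%:E * P y (path_from0 @^-1` E).
Proof.
move=> [n [t [B [t0 mB ->]]]]; rewrite kE.
rewrite (_ : A `&` _ = [set w | [/\ A w, s w < +oo &
    forall i, B i (X (fine (s w) + t i)%R w)]]); last first.
  apply/seteqP; split => w /=; first by move=> [Aw h]; split => //; case: (Ay Aw).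
  by move=> [].
rewrite (diffusion_strong_markov hX)//.
have -> : A `&` [set w | s w < +oo] = A.
  by apply/setIidPl => w /Ay[].
rewrite (eq_integral (cst (P y (path_from0 @^-1` path_cylinder t B)))).
  by rewrite integral_cst// muleC.
move=> w; rewrite inE => /Ay[_]; rewrite /at_time => -> /=; congr (P y _).
by apply/seteqP; split => v /= h i; have := h i; rewrite /= add0r.
Qed.

(** Cylinders form a generating pi-system, so the restart at [y] extends from them to exit events,
    which involve a continuum of times. *)
Lemma strong_markov_event E : measurable E ->
  P p (A `&` path_after s0 @^-1` E) = P p A * P y (path_from0 @^-1` E).
Proof.
move=> mE; rewrite -kE.
apply: (transfer_measure (path_after_measurable s0 ms) path_from0_measurable
  mA _ _ (@path_cylindersI _ G) (@path_cylindersT _ G) cylinders_eq) => //.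
by rewrite ltey_eq fin_num_measure.
Qed.

Lemma strong_markov_integral E (h : path_space G -> \bar R) : measurable E ->
  measurable_fun setT h -> (forall f, 0 <= h f) ->
  \int[P p]_(w in A `&` path_after s0 @^-1` E) h (path_after s0 w) =
  P p A * \int[P y]_(w in path_from0 @^-1` E) h (path_from0 w).
Proof.
move=> mE mh h0; rewrite -kE.
apply: (transfer_integral (path_after_measurable s0 ms) path_from0_measurable
  mA _ _ (@path_cylindersI _ G) (@path_cylindersT _ G) cylinders_eq) => //.
by rewrite ltey_eq fin_num_measure.
Qed.

End restart.
End strong_markov_paths.

(** * Exit from cells and embedding times *)

Section cell_exit.
Context {R : realType} {G : metric_graph R}.
Variables (VD : set (gpoint G)) (hVD : subdivision VD).
Implicit Types (f : R -> gpoint G) (A B U : set (gpoint G)) (y : gpoint G).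

Lemma subset_hit f A B s : A `<=` B -> hit f B s <= hit f A s.
Proof.
move=> AB; apply: le_ereal_inf_tmp => _ [t [t0 [st At]] <-].
by apply: hit_le => //; exact: AB.
Qed.

Lemma hit_shift f A (r : R) : (0 <= r)%R ->
  hit f A r%:E = r%:E + hit (fun t => f (r + t)%R) A 0.
Proof.
move=> r0; apply/eqP; rewrite eq_le; apply/andP; split.
  rewrite -leeBlDl//; apply: le_ereal_inf_tmp => _ [t [t0 [_ At]] <-].
  rewrite leeBlDl// -EFinD; apply: hit_le => //; first by rewrite addr_ge0.
  by rewrite lee_fin lerDl.
apply: le_ereal_inf_tmp => _ [t [t0 [rt At]] <-].
rewrite lee_fin in rt.
have -> : t%:E = r%:E + (t - r)%:E by rewrite -EFinD addrC subrK.
apply: leeD2l; apply: hit_le => /=.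
- by rewrite subr_ge0.
- by rewrite lee_fin subr_ge0.
- by rewrite addrC subrK.
Qed.

(** The cell meets [VD] only at [y], so a visit to another point of [VD] takes place outside [U].
    Conversely, by continuity the path leaves the open set [U] through its boundary, which lies in
    [VD]. *)
Lemma hit_cell f U y : continuous_path f -> VD y -> cell VD U y -> f 0%R = y ->
  hit f (VD `\ y) 0 = hit f (~` U) 0.
Proof.
move=> cf Vy [oU _ bU UV] f0.
have Uy : U y by have : [set y] y by []; rewrite -UV => -[].
apply/eqP; rewrite eq_le; apply/andP; split; last first.
  apply: subset_hit => p [Vp py] Up; apply: py.
  by rewrite -[_ p]/([set y] p) -UV.
have [/eqP ->|hoo] := boolP (hit f (~` U) 0 == +oo); first by rewrite leey.
have clU : closed (~` U) by exact: open_closedC.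
rewrite -ltey in hoo; have [t [ht t0 nUt]] := hit_attained cf clU hoo.
rewrite ht; apply: hit_le => //.
have tpos : (0 < t)%R.
  rewrite lt_neqAle t0 andbT; apply/eqP => tE; apply: nUt.
  by rewrite -tE f0.
split=> [|/= fty]; last by apply: nUt; rewrite /= fty.
apply: bU; split; last by move/interior_subset.
move=> V /(continuous_pathP cf t0)[e e0 he].
(* A time shortly before the exit time [t]: the path is still in [U] there, which puts [f t] in the
   closure of [U]. *)
pose u := Num.max 0%R (t - e / 2)%R.
have u0 : (0 <= u)%R by rewrite le_max lexx.
have ut : (u < t)%R by rewrite gt_max tpos ltrBlDr ltrDl divr_gt0.
exists (f u); split; last first.
  apply: he => //; rewrite ger0_norm ?subr_ge0 ?(ltW ut)//.
  have : (t - e / 2 <= u)%R by rewrite le_max lexx orbT.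
  by lra.
apply: contrapT => nUu.
have : hit f (~` U) 0 <= u%:E by apply: hit_le.
by rewrite ht lee_fin leNgt ut.
Qed.

(** Matches a jump of the embedded chain to [y'] with the event [T_U = T_y'] of the STMCA. A vertex
    [y'] reached at the exit is outside [U], so it cannot have been hit earlier. *)
Lemma hit_cell_at f U y y' : continuous_path f -> VD y -> VD y' -> cell VD U y ->
  f 0%R = y ->
  (hit f (VD `\ y) 0 < +oo /\ f (fine (hit f (VD `\ y) 0)) = y') <->
  (hit f (~` U) 0 = hit f [set y'] 0 /\ hit f (~` U) 0 < +oo).
Proof.
move=> cf Vy Vy' cU f0; have UE := hit_cell cf Vy cU f0.
have clV A : A `<=` VD -> closed A by exact: subset_subdivision_closed.
split.
  move=> [hoo fy']; rewrite -UE; split => //.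
  have [t [ht t0 [Vt nyt]]] := hit_attained cf (clV _ (@subDsetl _ _ _)) hoo.
  rewrite ht /= in fy'; apply/eqP; rewrite eq_le; apply/andP; split.
    rewrite UE; apply: subset_hit => p -> Uy'; apply: nyt.
    by rewrite fy'; case: cU => _ _ _ <-.
  by rewrite ht; apply: hit_le.
move=> [hE hoo]; rewrite UE; split => //.
rewrite hE in hoo *.
have cl : closed [set y'] by apply: clV => p ->.
by have [t [ht _ ft]] := hit_attained cf cl hoo; rewrite ht.
Qed.

End cell_exit.

Lemma first_timeE (R : realType) (G : metric_graph R) (d : measure_display)
  (Omega : measurableType d) (X : R -> Omega -> gpoint G) A s w :
  first_time X A s w = hit (X^~ w) A s.
Proof. by []. Qed.

(** * Embedding times and single steps *)

Section embedding.
Context {R : realType} {G : metric_graph R} {d : measure_display}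
  {Omega : measurableType d}.
Variables (D : diffusion_data G) (F : R -> set (set Omega))
  (P : gpoint G -> probability Omega R) (X : R -> Omega -> gpoint G).
Hypothesis hX : general_diffusion D F P X.
Variables (VD : set (gpoint G)) (hVD : subdivision VD).
Variables (U : gpoint G -> set (gpoint G)) (hU : cells_of VD U).
Variables (x : gpoint G) (hx : VD x).

Let hF : filtration F := diffusion_filtration hX.
Let aX : adapted F X := diffusion_adapted hX.
Let cX : forall w, continuous_path (X^~ w) := @diffusion_path _ _ _ _ _ _ _ _ hX.
Let clV A : A `<=` VD -> closed A := @subset_subdivision_closed _ _ _ hVD A.

Let tau := embedding_time X VD.
Let emb := embedded X VD.

Lemma embedding_time_vertex k w : tau k.+1 w < +oo -> VD (emb k.+1 w).
Proof.
rewrite /emb /embedded /at_time /tau.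
case: k => [|k] /= hoo.
  by have [t [ht _ Vt]] := hit_attained (@cX w) (clV (@subset_refl _ _)) hoo;
    rewrite first_timeE ht.
have [t [ht _ [Vt _]]] := hit_attained (@cX w) (clV (@subDsetl _ _ _)) hoo.
by rewrite first_timeE ht.
Qed.

Lemma embedding_time_le k w : tau k w <= tau k.+1 w.
Proof. by case: k => [|k]; exact: (hit_ge (X^~ w)). Qed.

(** The target set of the next embedding time is random, since it excludes the current vertex.
    Splitting over the countably many values [g m] of that vertex leaves fixed closed targets. *)
Lemma embedding_time_stopping k : stopping_time F (tau k).
Proof.
have st0 : stopping_time F (cst 0).
  split => // t t0; apply/(filtrationP hF _ t0).
  rewrite (_ : mkset _ = setT); first exact: measurableT.
  by apply/seteqP; split => // w _ /=; rewrite lee_fin.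
elim: k => [//|[_|k ih]].
  exact: (first_time_stopping hF aX (@cX) st0 (clV (@subset_refl _ _))).
split=> [w|t t0]; first exact: (hit_ge0 (X^~ w)).
apply/(filtrationP hF _ t0).
have [g [f [Vg gf _]]] := subdivision_enum hVD hx.
rewrite (_ : mkset _ = \bigcup_m (
   ([set w | tau k.+1 w < +oo /\ [set g m] (at_time X (tau k.+1) w)] `&`
   [set w | tau k.+1 w <= t%:E]) `&`
   [set w | first_time X (VD `\ g m) (tau k.+1 w) w <= t%:E])).
  apply: bigcupT_measurable => m.
  apply: measurableI; apply/(filtrationP hF _ t0).
    by apply: (at_time_stopped hF aX (@cX) ih _).2 => //; apply: clV => _ ->.
  by apply: (first_time_stopping hF aX (@cX) ih (clV (@subDsetl _ _ _))).2.
apply/seteqP; split => w /=.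
  move=> h; have st := le_trans (embedding_time_le k.+1 w) h.
  have soo := le_lt_trans st (ltry _).
  have gf' := gf _ (embedding_time_vertex soo).
  exists (f (emb k.+1 w)) => //=; rewrite gf'.
  by split.
by move=> [m _ [[[soo <-] st]]].
Qed.

Lemma embedded_measurable k : measurable_fun setT (emb k).
Proof.
have mX t : (0 <= t)%R -> measurable_fun setT (X t : Omega -> borel G).
  exact: (diffusion_measurable hX).
have st := embedding_time_stopping k.
apply: (at_time_measurable (@cX) mX); first by case: st.
exact: stopping_time_measurable st.
Qed.

(** The coordinate process on path space is adapted to the constant filtration, so its hitting times
    are covered by the previous results. *)
Lemma path_hit_measurable A : closed A ->
  measurable_fun setT (fun f : path_space G => hit (sval f) A 0).
Proof.
move=> cA.
have aC : adapted (fun _ : R => @measurable _ (path_space G)) (@coord R G).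
  move=> t B t0 mB; rewrite -[X in measurable X]setTI.
  exact: coord_measurable.
apply: (first_time_measurable (@filtration_measurable R _ (path_space G)) aC
  (@coord_continuous R G) (s := cst 0)) => //.
by apply: measurable_stopping_time => //; exact: measurable_cst.
Qed.

(** The event [exit_at] carried to path space, where it can be evaluated on the path after a
    stopping time. *)
Definition exit_event y y' : set (path_space G) :=
  [set f | hit (sval f) (~` U y) 0 = hit (sval f) [set y'] 0 /\
           hit (sval f) (~` U y) 0 < +oo].

Let clU y : VD y -> closed (~` U y).
Proof. by move=> /hU[oU _ _ _]; exact: open_closedC. Qed.

Let cl1 y : VD y -> closed [set y].
Proof. by move=> Vy; apply: clV => _ ->. Qed.

Lemma exit_event_measurable y y' : VD y -> VD y' -> measurable (exit_event y y').
Proof.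
move=> Vy Vy'; apply: measurableI; last first.
  rewrite -[X in measurable X]setTI.
  by apply: emeasurable_fun_infty_o => //; apply: path_hit_measurable; exact: clU.
rewrite -[X in measurable X]setTI.
by apply: measurable_eqe => //; apply: path_hit_measurable; [exact: clU|exact: cl1].
Qed.

Lemma sval_path_from0 w : sval (path_from0 hX w) = X^~ w.
Proof. by apply/funext => t /=; rewrite add0r. Qed.

Lemma path_from0_exit y y' : path_from0 hX @^-1` exit_event y y' = exit_at X U y y'.
Proof. by apply/funext => w; rewrite /preimage /exit_event /mkset sval_path_from0. Qed.

Let s0 k w : 0 <= tau k w. Proof. by case: (embedding_time_stopping k). Qed.

(** The index starts at [k.+1] because only from [tau 1] on does the path sit at the centre of a
    cell. There [hit_shift] restarts the path and [hit_cell] turns the next visit into an exit. *)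
Lemma next_embedding_time k w : tau k.+1 w < +oo ->
  tau k.+2 w = tau k.+1 w +
    hit (sval (path_after hX (s0 k.+1) w)) (~` U (emb k.+1 w)) 0.
Proof.
move=> soo; have Vy := embedding_time_vertex soo.
have sE : tau k.+1 w = (fine (tau k.+1 w))%:E by rewrite fineK// ge0_fin_numE.
have cq := svalP (path_after hX (s0 k.+1) w).
rewrite -(hit_cell cq Vy (hU Vy)); last by rewrite /= addr0.
transitivity (hit (X^~ w) (VD `\ emb k.+1 w) (fine (tau k.+1 w))%:E).
  by rewrite -sE.
by rewrite (hit_shift (X^~ w)) ?fine_ge0// -sE.
Qed.

Lemma next_embedded k w y' : tau k.+1 w < +oo -> VD y' ->
  (tau k.+2 w < +oo /\ emb k.+2 w = y') <->
  exit_event (emb k.+1 w) y' (path_after hX (s0 k.+1) w).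
Proof.
move=> soo Vy'; have Vy := embedding_time_vertex soo.
have cq := svalP (path_after hX (s0 k.+1) w).
have f0 : sval (path_after hX (s0 k.+1) w) 0%R = emb k.+1 w by rewrite /= addr0.
rewrite /exit_event /mkset -(hit_cell_at hVD cq Vy Vy' (hU Vy) f0).
rewrite /emb /embedded /at_time -/tau next_embedding_time//.
rewrite -(hit_cell cq Vy (hU Vy) f0).
set h := hit _ _ _.
have sE : tau k.+1 w = (fine (tau k.+1 w))%:E by rewrite fineK// ge0_fin_numE.
have h0 : 0 <= h by exact: hit_ge0.
have -> : (tau k.+1 w + h < +oo) = (h < +oo).
  by rewrite sE; case: h h0 => [r| |] // _; rewrite ?ltry.
suff : h < +oo -> X (fine (tau k.+1 w + h)) w =
   sval (path_after hX (s0 k.+1) w) (fine h).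
  by move=> E; split => -[hoo]; rewrite ?E// => <-; rewrite ?E.
by move=> hoo; rewrite fineD// ge0_fin_numE.
Qed.

Section step.
Variables (p y y' : gpoint G) (k : nat) (A : set Omega).
Hypotheses (sA : stopped_events F (tau k.+1) A) (Vy : VD y) (Vy' : VD y').
Hypothesis Ay : forall w, A w -> tau k.+1 w < +oo /\ emb k.+1 w = y.

Let stepE : A `&` [set w | tau k.+2 w < +oo /\ emb k.+2 w = y'] =
  A `&` path_after hX (s0 k.+1) @^-1` exit_event y y'.
Proof.
by apply/seteqP; split => w [Aw] h; split => //; have [soo yE] := Ay Aw;
  move: h => /=; rewrite next_embedded// yE.
Qed.

Lemma step_prob :
  P p (A `&` [set w | tau k.+2 w < +oo /\ emb k.+2 w = y']) =
  P p A * transition_prob P X U y y'.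
Proof.
rewrite stepE (strong_markov_event hX p (s0 k.+1) (embedding_time_stopping k.+1) sA Ay).
  by rewrite path_from0_exit.
exact: exit_event_measurable.
Qed.

(** On [A] the duration of the step is the exit time of the restarted path, so the strong Markov
    property in its integral form applies. *)
Lemma step_time :
  \int[P p]_(w in A `&` [set w | tau k.+2 w < +oo /\ emb k.+2 w = y'])
    (tau k.+2 w - tau k.+1 w) =
  P p A * \int[P y]_(w in exit_at X U y y') exit_time X (U y) w.
Proof.
rewrite stepE.
rewrite (eq_integral (fun w => hit (sval (path_after hX (s0 k.+1) w)) (~` U y) 0)).
  rewrite (strong_markov_integral hX p (s0 k.+1) (embedding_time_stopping k.+1) sA Ay
    (exit_event_measurable Vy Vy') (path_hit_measurable (clU Vy))).
    rewrite path_from0_exit; congr (_ * _); apply: eq_integral => w _.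
    by rewrite sval_path_from0.
  by move=> f; exact: hit_ge0.
move=> w; rewrite inE => -[Aw _]; have [soo <-] := Ay Aw.
by rewrite next_embedding_time// addeAC subee ?add0e ?ge0_fin_numE.
Qed.

End step.
End embedding.

(** * Chains and sequences *)

Lemma measurable_prop d (T : measurableType d) (Q : Prop) :
  measurable [set _ : T | Q].
Proof.
have [q|nq] := pselect Q.
  by rewrite (_ : mkset _ = setT)//; apply/seteqP; split.
by rewrite (_ : mkset _ = set0)//; apply/seteqP; split.
Qed.

Lemma measurable_prefix d (T : measurableType d) (A : nat -> set T) k :
  (forall i, measurable (A i)) ->
  measurable [set w | forall i, (i <= k)%N -> A i w].
Proof.
move=> mA; rewrite (_ : mkset _ = \bigcap_i ([set _ | (k < i)%N] `|` A i)).
  apply: bigcapT_measurable => i; apply: measurableU => //; exact: measurable_prop.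
apply/seteqP; split => w /= h i.
  by move=> _; have [ik|ki] := leqP i k; [right; exact: h|left].
by move=> ik; have [] := h i Logic.I => //=; rewrite ltnNge ik.
Qed.

Section stmca_measurable.
Context {R : realType} {G : metric_graph R} {d : measure_display}
  {Omega : measurableType d}.
Variables (P : gpoint G -> probability Omega R) (X : R -> Omega -> gpoint G)
  (U : gpoint G -> set (gpoint G)).

Lemma transition_time_ge0 y y' : 0 <= transition_time P X U y y'.
Proof.
apply: mule_ge0; last by rewrite lee_fin invr_ge0 fine_ge0// measure_ge0.
by apply: integral_ge0 => w _; exact: (hit_ge0 (X^~ w)).
Qed.

Section one_chain.
Context {d' : measure_display} {Omega' : measurableType d'}.
Variable Y : nat -> Omega' -> gpoint G.

Lemma jump_time_le k k' w : (k <= k')%N ->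
  jump_time P X U Y k w <= jump_time P X U Y k' w.
Proof.
move=> kk'; rewrite /jump_time (big_cat_nat (leq0n k) kk')//=; apply: leeDl.
by apply: sume_ge0 => i _; exact: transition_time_ge0.
Qed.

(** The jump times are nondecreasing, so at most one interval contains [t] and the choice made by
    [xget] is forced. *)
Lemma stmca_jump z t k w :
  jump_time P X U Y k w <= t%:E < jump_time P X U Y k.+1 w ->
  stmca P X U Y z t w = Y k.+1 w.
Proof.
move=> kt; rewrite /stmca.
case: xgetP => [y _ [k' [k't ->]]|/(_ (Y k.+1 w))[]]; last first.
  by exists k.
have lt_absurd i j : jump_time P X U Y i w <= t%:E < jump_time P X U Y i.+1 w ->
    jump_time P X U Y j w <= t%:E < jump_time P X U Y j.+1 w -> ~~ (i < j)%N.
  move=> /andP[_ h1] /andP[h2 _]; apply/negP => /(jump_time_le w) h.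
  by have := lt_le_trans h1 (le_trans h h2); rewrite ltxx.
suff -> : k' = k by [].
have k'k := lt_absurd _ _ k't kt; have kk' := lt_absurd _ _ kt k't.
by apply: anti_leq; rewrite leqNgt kk' leqNgt k'k.
Qed.

Lemma stmca_nojump z t w :
  (forall k, ~ (jump_time P X U Y k w <= t%:E < jump_time P X U Y k.+1 w)) ->
  stmca P X U Y z t w = z.
Proof.
by move=> h; rewrite /stmca; case: xgetP => // y _ [k [kt _]]; case: (h k).
Qed.

Variables (VD : set (gpoint G)) (hVD : subdivision VD).
Variables (x : gpoint G) (hx : VD x).
Hypothesis mY : forall k, measurable_fun setT (Y k : Omega' -> borel G).
Hypothesis VY : forall k w, VD (Y k w).

(** The chain has countably many values, so an arbitrary function [h] of two of its terms is
    measurable. *)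
Lemma measurable_of_steps (h : gpoint G -> gpoint G -> \bar R) i j :
  measurable_fun setT (fun w => h (Y i w) (Y j w)).
Proof.
move=> _ B mB; rewrite setTI; have [g [f [Vg gf _]]] := subdivision_enum hVD hx.
have mY1 k m : measurable [set w | Y k w = g m].
  have mg : measurable ([set g m] : set (borel G)).
    by apply: closed_borel; apply: (subset_subdivision_closed hVD) => _ ->.
  by rewrite -[X in measurable X]setTI; exact: (mY k measurableT mg).
rewrite (_ : _ @^-1` _ = \bigcup_m \bigcup_m'
  ([set _ | B (h (g m) (g m'))] `&`
   ([set w | Y i w = g m] `&` [set w | Y j w = g m']))).
  apply: bigcupT_measurable => m; apply: bigcupT_measurable => m'.
  apply: measurableI; last exact: measurableI.
  exact: measurable_prop.
apply/seteqP; split => w /=.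
  move=> Bw; exists (f (Y i w)) => //; exists (f (Y j w)) => //=.
  by rewrite !gf.
by move=> [m _ [m' _ [+ [-> ->]]]].
Qed.

Lemma jump_time_measurable k : measurable_fun setT (jump_time P X U Y k).
Proof. by apply: emeasurable_sum => i; exact: measurable_of_steps. Qed.

Lemma stmca_measurable z t :
  measurable_fun setT (stmca P X U Y z t : Omega' -> borel G).
Proof.
move=> _ B mB; rewrite setTI.
pose J k := [set w | jump_time P X U Y k w <= t%:E < jump_time P X U Y k.+1 w].
have mJ k : measurable (J k).
  rewrite (_ : J k = [set w | jump_time P X U Y k w <= t%:E] `&`
                     [set w | t%:E < jump_time P X U Y k.+1 w]); last first.
    by apply/seteqP; split => w /andP.
  apply: measurableI; rewrite -[X in measurable X]setTI.
    exact: emeasurable_fun_infty_c (jump_time_measurable k) _.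
  exact: emeasurable_fun_o_infty (jump_time_measurable k.+1) _.
rewrite (_ : _ @^-1` _ = \bigcup_k (J k `&` Y k.+1 @^-1` B) `|`
   (~` (\bigcup_k J k) `&` [set _ | B z])).
  apply: measurableU.
    apply: bigcupT_measurable => k; apply: measurableI => //.
    by rewrite -[X in measurable X]setTI; exact: mY.
  apply: measurableI; last first.
    exact: measurable_prop.
  by apply: measurableC; exact: bigcupT_measurable.
apply/seteqP; split => w /=.
  have [[k Jk]|nJ] := pselect (exists k, J k w).
    by rewrite (stmca_jump z Jk) => BY; left; exists k.
  rewrite stmca_nojump; last by move=> k Jk; apply: nJ; exists k.
  by move=> Bz; right; split => // -[k _ Jk]; apply: nJ; exists k.
move=> [[k _ [/stmca_jump ->//]]|[nJ Bz]].
by rewrite stmca_nojump// => k Jk; apply: nJ; exists k.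
Qed.

End one_chain.

(** Makes the STMCA a functional of the sequence of positions alone, which can be compared across
    sample spaces. *)
Lemma stmca_ext d1 d2 (O1 : measurableType d1) (O2 : measurableType d2)
  (Y1 : nat -> O1 -> gpoint G) (Y2 : nat -> O2 -> gpoint G) z t w1 w2 :
  (forall k, Y1 k w1 = Y2 k w2) ->
  stmca P X U Y1 z t w1 = stmca P X U Y2 z t w2.
Proof.
move=> Y12; have JE k : jump_time P X U Y1 k w1 = jump_time P X U Y2 k w2.
  by apply: eq_bigr => i _; rewrite !Y12.
rewrite /stmca; congr (xget z _); apply/funext => y; apply/propext.
by split => -[k [h ->]]; exists k; rewrite ?JE ?Y12// -!JE -?Y12.
Qed.

End stmca_measurable.

(** * The space of coded vertex sequences *)

Section sequences.
Context {R : realType} {G : metric_graph R}.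
Variable g : nat -> gpoint G.

(** Terms are compared through [g] because several codes may name the same vertex. *)
Definition seq_cylinder (k : nat) (a : nat -> nat) : set (nat -> nat) :=
  [set s | forall i, (i <= k)%N -> g (s i) = g (a i)].

(** The empty and the full set are added to obtain a pi-system containing the whole space. *)
Definition seq_cylinders : set (set (nat -> nat)) :=
  [set E | [\/ E = setT, E = set0 | exists k a, E = seq_cylinder k a]].

Definition seq_space : Type := g_sigma_algebraType seq_cylinders.

HB.instance Definition _ := Measurable.on seq_space.

(** Two cylinders are either nested or disjoint, according to whether their prefixes agree on the
    shorter length. *)
Lemma seq_cylindersI : setI_closed seq_cylinders.
Proof.
move=> A B [->|->|[k [a ->]]].
- by rewrite setTI.
- by rewrite set0I => _; exact: Or32.
move=> [->|->|[k' [a' ->]]].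
- by rewrite setIT; apply: Or33; exists k, a.
- by rewrite setI0; exact: Or32.
have wlog_le k1 k2 a1 a2 : (k1 <= k2)%N ->
    seq_cylinders (seq_cylinder k1 a1 `&` seq_cylinder k2 a2).
  move=> k12.
  have [aE|naE] := pselect (forall i, (i <= k1)%N -> g (a2 i) = g (a1 i)).
    apply: Or33; exists k2, a2; apply/seteqP; split => [s []//|s hs]; split => // i ik.
    by rewrite hs ?(leq_trans ik)// aE.
  apply: Or32; apply/seteqP; split => // s [h1 h2]; apply: naE => i ik.
  by rewrite -h2 ?(leq_trans ik)// h1.
have [kk'|/ltnW k'k] := leqP k k'; first exact: wlog_le.
by rewrite setIC; exact: wlog_le.
Qed.

Lemma term_measurable k :
  measurable_fun setT (fun s : seq_space => g (s k) : borel G).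
Proof.
move=> _ B mB; rewrite setTI.
(* The lists [l] run over the countably many possible prefixes. *)
rewrite (_ : _ @^-1` _ = \bigcup_(l : seq nat)
   ([set _ | B (g (nth 0%N l k))] `&` seq_cylinder k (nth 0%N l))).
  apply: countable_bigcupT_measurable => [|l]; first exact: countableP.
  apply: measurableI; first exact: measurable_prop.
  apply: sub_sigma_algebra; apply: Or33.
  by exists k, (nth 0%N l).
apply/seteqP; split => s /=.
  move=> Bs; exists (mkseq s k.+1) => //; split => /=; first by rewrite nth_mkseq.
  move=> i ik.
  by rewrite nth_mkseq.
by move=> [l _ [/= Bl ->]].
Qed.

Lemma seq_map_measurable d (Omega : measurableType d) (N : Omega -> seq_space) :
  (forall k a, measurable [set w | forall i, (i <= k)%N -> g (N w i) = g (a i)]) ->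
  measurable_fun setT N.
Proof.
move=> mN; apply: measurability => // _ [E SE <-]; rewrite setTI.
by case: SE => [->|->|[k [a ->]]]; [exact: measurableT|exact: measurable0|exact: mN].
Qed.

End sequences.

(** * Law of the embedded chain *)

Section chain_law.
Context {R : realType} {G : metric_graph R} {d : measure_display}
  {Omega : measurableType d}.
Variables (D : diffusion_data G) (F : R -> set (set Omega))
  (P : gpoint G -> probability Omega R) (X : R -> Omega -> gpoint G).
Hypothesis hX : general_diffusion D F P X.
Variables (VD : set (gpoint G)) (hVD : subdivision VD).
Variables (U : gpoint G -> set (gpoint G)) (hU : cells_of VD U).
Variables (x : gpoint G) (hx : VD x).
Context {d' : measure_display} {Omega' : measurableType d'}.
Variables (Q : probability Omega' R) (Y : nat -> Omega' -> gpoint G).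
Hypothesis hY : stmca_chain P X VD U Q Y x.

Let hF : filtration F := diffusion_filtration hX.
Let aX : adapted F X := diffusion_adapted hX.
Let cX : forall w, continuous_path (X^~ w) := @diffusion_path _ _ _ _ _ _ _ _ hX.
Let tau := embedding_time X VD.
Let emb := embedded X VD.
Let stau k : stopping_time F (tau k) := embedding_time_stopping hX hVD hx k.
Let mtau k : measurable_fun setT (tau k) := stopping_time_measurable hF (stau k).

Let cl1 y : VD y -> closed [set y].
Proof. by move=> Vy; apply: (subset_subdivision_closed hVD) => _ ->. Qed.

Let m1 y : VD y -> measurable ([set y] : set (borel G)).
Proof. by move=> Vy; apply: closed_borel; exact: cl1. Qed.

Let mtauoo k : measurable [set w | tau k w < +oo].
Proof. by rewrite -[X in measurable X]setTI; exact: emeasurable_fun_infty_o. Qed.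

(** The chain is read from [emb 1] on: [emb i.+1] is the counterpart of [Y i]. *)
Definition visits (y : nat -> gpoint G) (k : nat) : set Omega :=
  [set w | tau k.+1 w < +oo /\ forall i, (i <= k)%N -> emb i.+1 w = y i].

Let visits0 y : visits y 0 = [set w | tau 1 w < +oo /\ [set y 0%N] (emb 1 w)].
Proof.
apply/seteqP; split => w [h1 h2]; split => //; first exact: h2.
by move=> [|i].
Qed.

Let visitsS y k : visits y k.+1 =
  visits y k `&` [set w | tau k.+2 w < +oo /\ emb k.+2 w = y k.+1].
Proof.
apply/seteqP; split => w /=.
  move=> [h1 h2]; split; split => //; last exact: h2.
    exact: le_lt_trans (embedding_time_le _ _ _ _) h1.
  by move=> i ik; apply: h2; rewrite (leq_trans ik).
move=> [[_ h] [h1 h2]]; split => // i; rewrite leq_eqVlt => /predU1P[->//|].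
exact: h.
Qed.

Lemma visits_stopped y k : (forall i, VD (y i)) ->
  stopped_events F (tau k.+1) (visits y k).
Proof.
move=> Vy; elim: k => [|k ih].
  rewrite visits0; exact: (at_time_stopped hF aX (@cX) (stau 1) (cl1 (Vy 0%N))).
rewrite visitsS; apply: stopped_eventsI => //.
  apply: (stopped_events_le hF (stau k.+1)) ih => //.
  by move=> w; exact: embedding_time_le.
exact: (at_time_stopped hF aX (@cX) (stau k.+2) (cl1 (Vy k.+1))).
Qed.

Let start : P x [set w | X 0%R w = x] = 1 := diffusion_start hX x.

Let mstart : measurable [set w | X 0%R w = x].
Proof.
rewrite -[X in measurable X]setTI.
exact: (diffusion_measurable hX (lexx 0%R) measurableT (m1 hx)).
Qed.

Lemma embedding_start w : X 0%R w = x -> tau 1 w = 0 /\ emb 1 w = x.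
Proof.
move=> Xx; suff t0 : tau 1 w = 0 by split => //; rewrite /emb /embedded /at_time -/tau t0.
apply/eqP; rewrite eq_le; apply/andP; split; last exact: (hit_ge (X^~ w)).
by apply: (@hit_le _ _ (X^~ w)) => //; rewrite Xx.
Qed.

Lemma ae_start : {ae P x, forall w, X 0%R w = x}.
Proof.
exists (~` [set w | X 0%R w = x]); split => //; first exact: measurableC.
by rewrite probability_setC// start subee.
Qed.

(** Induction on [k]: [step_prob] gives the embedded chain the same transition factor as [Y], and
    both start at [x] almost surely. *)
Lemma visits_law y k : (forall i, VD (y i)) ->
  P x (visits y k) = Q [set w | forall i, (i <= k)%N -> Y i w = y i].
Proof.
case: hY => _ _ [mu0 [/(_ hx) mu0E _] Q0] Qk Vy.
elim: k => [|k ih]; last first.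
  rewrite Qk// -ih visitsS.
  apply: (step_prob hX hVD hU hx x) => //; first exact: visits_stopped.
  by move=> w [h1 h2]; split => //; exact: h2.
rewrite (_ : [set w | _] = [set w | Y 0%N w = y 0%N]); last first.
  by apply/seteqP; split => w /= h; [exact: h|case].
rewrite Q0// mu0E visits0.
have mv : measurable [set w | tau 1 w < +oo /\ [set y 0%N] (emb 1 w)].
  by case: (at_time_stopped hF aX (@cX) (stau 1) (cl1 (Vy 0%N))).
have [yx|yx] := eqVneq (y 0%N) x.
  apply/eqP; rewrite eq_le probability_le1 // -start; apply: le_measure; rewrite ?inE//.
  move=> w /embedding_start[te ee].
  by split; [rewrite /mkset te; exact: lt0y|rewrite ee yx].
have nstart : P x (~` [set w | X 0%R w = x]) = 0.
  by rewrite probability_setC// start subee.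
apply/eqP; rewrite -[X in _ == X]/(0 : \bar R) -measure_le0 -nstart.
apply: le_measure; rewrite ?inE//; first exact: measurableC.
move=> w [_ /= embE] /embedding_start[_]; rewrite embE => /eqP.
by rewrite (negbTE yx).
Qed.

Variables (g : nat -> gpoint G) (f : gpoint G -> nat).
Hypotheses (Vg : forall m, VD (g m)) (gf : forall y, VD y -> g (f y) = y)
  (fx : forall y, ~ VD y -> f y = f x).

(** The embedded position may lie off [VD], for instance at an infinite time. There [f] is constant,
    and every subset of [VD] is closed, so the level sets of [f] are Borel. *)
Lemma embedded_code_measurable k m : measurable [set w | f (emb k w) = m].
Proof.
have mf : measurable ([set y | f y = m] : set (borel G)).
  rewrite (_ : mkset _ = (VD `&` [set y | f y = m]) `|`
      (~` VD `&` [set _ | f x = m])).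
    apply: measurableU.
      by apply: closed_borel; apply: (subset_subdivision_closed hVD); exact: subIsetl.
    apply: measurableI; last exact: measurable_prop.
    apply: measurableC; apply: closed_borel.
    by apply: (subset_subdivision_closed hVD).
  apply/seteqP; split => y /=.
    by have [Vy|nVy] := pselect (VD y); [left|right; rewrite -(fx nVy)].
  by move=> [[]//|[/fx ->]].
rewrite -[X in measurable X]setTI.
exact: (embedded_measurable hX hVD hx k measurableT mf).
Qed.

Let mYeq k y : VD y -> measurable [set w | Y k w = y].
Proof. by case: hY => mY _ _ _ Vy; have := mY k measurableT _ (m1 Vy); rewrite setTI. Qed.

Lemma chain_code_measurable k m : measurable [set w | f (Y k w) = m].
Proof.
have [mY VY _ _] := hY.
have -> : [set w | f (Y k w) = m] =
    \bigcup_j ([set _ | f (g j) = m] `&` [set w | Y k w = g j]).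
  apply/seteqP; split => w /=.
    by move=> fm; exists m => //=; rewrite -fm !gf.
  by move=> [j _ [h ->]].
apply: bigcupT_measurable => j; apply: measurableI; first exact: measurable_prop.
exact: mYeq.
Qed.

(* Both sides are summed over the next vertex: [Y] loses no mass. *)
Let visits_next y k : (forall i, VD (y i)) ->
  P x (visits y k `&` [set w | tau k.+2 w < +oo]) = P x (visits y k).
Proof.
move=> Vy; have [mY VY _ _] := hY.
have mv : measurable (visits y k) by case: (visits_stopped k Vy).
have mQ : measurable [set w | forall i, (i <= k)%N -> Y i w = y i].
  by apply: (@measurable_prefix _ _ (fun i => [set w | Y i w = y i])) => i; exact: mYeq.
rewrite [RHS]visits_law//.
have -> : visits y k `&` [set w | tau k.+2 w < +oo] = \bigcup_m
    (visits y k `&` [set w | tau k.+2 w < +oo /\ f (emb k.+2 w) = m]).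
  apply/seteqP; split => w; first by move=> [h1 h2]; exists (f (emb k.+2 w)).
  by move=> [m _ [h1 [h2 _]]].
have {1}-> : [set w | forall i, (i <= k)%N -> Y i w = y i] = \bigcup_m
    ([set w | forall i, (i <= k)%N -> Y i w = y i] `&` [set w | f (Y k.+1 w) = m]).
  apply/seteqP; split => w; first by move=> h; exists (f (Y k.+1 w)).
  by move=> [m _ []].
have mA m : measurable (visits y k `&` [set w | tau k.+2 w < +oo /\ f (emb k.+2 w) = m]).
  apply: measurableI => //; apply: measurableI; first exact: mtauoo.
  exact: embedded_code_measurable.
have mB m : measurable ([set w | forall i, (i <= k)%N -> Y i w = y i] `&`
    [set w | f (Y k.+1 w) = m]).
  by apply: measurableI => //; exact: chain_code_measurable.
rewrite !measure_semi_bigcup//; first last.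
- exact: bigcupT_measurable.
- by apply/trivIsetP => i j _ _ ij; apply/seteqP; split => // w [[_ [_ fi]] [_ [_ fj]]];
    move: ij; rewrite -fi -fj eqxx.
- exact: bigcupT_measurable.
- by apply/trivIsetP => i j _ _ ij; apply/seteqP; split => // w [[_ fi] [_ fj]];
    move: ij; rewrite -fi -fj eqxx.
apply: eq_eseriesr => m _.
(* An integer [m] with [f (g m) != m] is the code of no vertex and contributes zero to both sums. *)
have [fgm|fgm] := eqVneq (f (g m)) m; last first.
  rewrite (_ : _ `&` _ = set0); last first.
    apply/seteqP; split => // w [_ [h fm]].
    by move: fgm; rewrite -fm gf ?eqxx//; exact: (embedding_time_vertex hX hVD).
  rewrite (_ : _ `&` _ = set0) ?measure0//.
  apply/seteqP; split => // w [_ /= fm].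
  by move: fgm; rewrite -fm gf ?eqxx.
(* The word [y] up to [k], followed by [g m]. *)
pose y' i := if (i <= k)%N then y i else g m.
have Vy' i : VD (y' i) by rewrite /y'; case: ifP.
have y'E i : (i <= k)%N -> y' i = y i by rewrite /y' => ->.
have y'k : y' k.+1 = g m by rewrite /y' ltnn.
transitivity (P x (visits y' k.+1)).
  rewrite visitsS y'k; congr (P x (_ `&` _)).
    by apply/seteqP; split => w [h1 h2]; split => // i ik; rewrite h2// y'E.
  apply/seteqP; split => w [h1 h2]; split => //; last by rewrite h2.
  by rewrite -h2 gf//; exact: (embedding_time_vertex hX hVD).
rewrite visits_law//; congr (Q _); apply/seteqP; split => w /=.
  move=> h; split => [i ik|]; last by rewrite h// y'k.
  by rewrite h ?y'E// (leq_trans ik).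
move=> [h fm] i; rewrite leq_eqVlt => /predU1P[->|ik].
  by rewrite y'k -fm gf.
by rewrite y'E ?h.
Qed.

Let tau_le j k w : (j <= k)%N -> tau j w <= tau k w.
Proof.
elim: k => [|k ih]; first by rewrite leqn0 => /eqP ->.
rewrite leq_eqVlt => /predU1P[->//|/ih h]; apply: le_trans h _.
exact: embedding_time_le.
Qed.

(** Induction on [k]: by [visits_next] the next time is almost surely finite after any given word of
    visited vertices, and there are countably many words. *)
Lemma embedding_times_finite : {ae P x, forall w, forall k, tau k w < +oo}.
Proof.
apply: ae_foralln => -[|k]; first by apply: aeW => w; exact: lt0y.
elim: k => [|k ih].
  apply: filterS ae_start => w /embedding_start[-> _]; exact: lt0y.
(* Every finite list of codes is some [unpickle n], so the [y n] realise all prefixes. *)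
pose y n i := g (nth 0%N (odflt [::] (unpickle n : option (seq nat))) i).
have Vy n i : VD (y n i) by exact: Vg.
have : (P x).-negligible (\bigcup_n (visits (y n) k `\` [set w | tau k.+2 w < +oo])).
  apply: negligible_bigcup => n; apply/negligibleP.
    by apply: measurableD => //; case: (visits_stopped k (Vy n)).
  have mv : measurable (visits (y n) k) by case: (visits_stopped k (Vy n)).
  rewrite measureD//; last by rewrite ltey_eq fin_num_measure.
  have sub_eq0 (a b : \bar R) : b = a -> a \is a fin_num -> a - b = 0.
    by move=> -> ?; rewrite subee.
  by apply: sub_eq0; [exact: visits_next|exact: fin_num_measure].
move=> nv; have {}nv : {ae P x, forall w,
    ~ (\bigcup_n (visits (y n) k `\` [set w | tau k.+2 w < +oo])) w}.
  by apply: negligibleS nv => w /= /contrapT.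
apply: filterS2 ih nv => w soo nv; rewrite ltNge; apply/negP => too; apply: nv.
exists (pickle (mkseq (fun i => f (emb i.+1 w)) k.+1)) => //; split; last first.
  by rewrite /mkset ltNge too.
split => // i ik; rewrite /y pickleK /= nth_mkseq// gf//.
apply: (embedding_time_vertex hX hVD); apply: le_lt_trans soo; exact: tau_le.
Qed.

End chain_law.

(** * Conditional durations *)

Lemma g_sigma_preimageU_measurable d d1 d2 (T : measurableType d)
  (T1 : measurableType d1) (T2 : measurableType d2) (e1 : T -> T1) (e2 : T -> T2) A :
  measurable_fun setT e1 -> measurable_fun setT e2 ->
  g_sigma_preimageU e1 e2 A -> measurable A.
Proof.
move=> me1 me2; apply: smallest_sub; first exact: sigma_algebra_measurable.
by move=> _ [[B mB <-]|[B mB <-]]; [exact: me1|exact: me2].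
Qed.

(** The sets that do not separate [w] from [w'] form a sigma-algebra containing the generators. *)
Lemma g_sigma_preimageU_atom d1 d2 (T : Type)
  (T1 : measurableType d1) (T2 : measurableType d2) (e1 : T -> T1) (e2 : T -> T2) A w w' :
  g_sigma_preimageU e1 e2 A -> e1 w = e1 w' -> e2 w = e2 w' -> A w -> A w'.
Proof.
move=> SA e1E e2E.
pose inv : set (set T) := [set B | B w <-> B w'].
suff : inv A by move=> [].
apply: (smallest_sub _ _ SA).
- split => [|B iB|B iB] //=.
  + by rewrite setTD; split => nB Bw; apply: nB; apply/iB.
  + by split => -[n _ Bn]; exists n => //; apply/(iB n).
- by move=> _ [[B mB <-]|[B mB <-]]; rewrite /inv /= ?e1E ?e2E.
Qed.

Section almost_everywhere_equal.
Context {R : realType} {d : measure_display} {T : measurableType d}.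
Variables (mu : {measure set T -> \bar R}) (A B : set T).
Hypotheses (mA : measurable A) (mB : measurable B).
Hypothesis AB : {ae mu, forall w, A w <-> B w}.

Lemma ae_measure_eq : mu A = mu B.
Proof.
have [N [mN muN subN]] := AB.
have le_AB (S S' : set T) : measurable S -> measurable S' ->
    (forall w, ~ N w -> S w -> S' w) -> mu S <= mu S'.
  move=> mS mS' SS'; rewrite -[leRHS]adde0 -[X in _ + X]muN.
  apply: le_trans (measureU2 mu mS' mN); apply: le_measure; rewrite ?inE//.
    exact: measurableU.
  by move=> w Sw; have [Nw|nNw] := pselect (N w); [right|left; exact: SS'].
have ABN w : ~ N w -> (A w <-> B w).
  by move=> nNw; apply: contrapT => h; apply: nNw; exact: subN.
by apply/eqP; rewrite eq_le !le_AB// => w /ABN[].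
Qed.

Lemma ae_integral_eq (h : T -> \bar R) : measurable_fun setT h ->
  \int[mu]_(w in A) h w = \int[mu]_(w in B) h w.
Proof.
move=> mh; rewrite integral_mkcond [RHS]integral_mkcond.
apply: ae_eq_integral => //.
- by apply/(measurable_restrictT _ _).1 => //; exact: measurable_funS mh.
- by apply/(measurable_restrictT _ _).1 => //; exact: measurable_funS mh.
apply: filterS AB => w ABw _; rewrite /patch.
by congr (if _ then _ else _); apply/idP/idP; rewrite !inE => /ABw.
Qed.

End almost_everywhere_equal.

Section conditional_times.
Context {R : realType} {G : metric_graph R} {d : measure_display}
  {Omega : measurableType d}.
Variables (D : diffusion_data G) (F : R -> set (set Omega))
  (P : gpoint G -> probability Omega R) (X : R -> Omega -> gpoint G).
Hypothesis hX : general_diffusion D F P X.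
Variables (VD : set (gpoint G)) (hVD : subdivision VD).
Variables (U : gpoint G -> set (gpoint G)) (hU : cells_of VD U).
Variables (x : gpoint G) (hx : VD x).

Let hF : filtration F := diffusion_filtration hX.
Let aX : adapted F X := diffusion_adapted hX.
Let cX : forall w, continuous_path (X^~ w) := @diffusion_path _ _ _ _ _ _ _ _ hX.
Let tau := embedding_time X VD.
Let emb := embedded X VD.
Let stau k : stopping_time F (tau k) := embedding_time_stopping hX hVD hx k.
Let mtau k : measurable_fun setT (tau k) := stopping_time_measurable hF (stau k).
Let memb k : measurable_fun setT (emb k) := embedded_measurable hX hVD hx k.

Let cl1 y : VD y -> closed [set y].
Proof. by move=> Vy; apply: (subset_subdivision_closed hVD) => _ ->. Qed.

Let m1 y : VD y -> measurable ([set y] : set (borel G)).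
Proof. by move=> Vy; apply: closed_borel; exact: cl1. Qed.

Variable C : nat -> Omega -> \bar R.
Hypothesis hC : forall n : nat,
    cond_expectation (P x) (g_sigma_preimageU (emb n) (emb n.+1))
      (fun w => tau n.+1 w - tau n w) (C n.+1).

Lemma cond_expectation_measurable n : measurable_fun setT (C n.+1).
Proof.
move=> _ B mB; rewrite setTI.
by apply: (g_sigma_preimageU_measurable (memb n) (memb n.+1)); exact: (hC n).1.
Qed.

(** The level set of [C n.+1] through [w] lies in the generated sigma-algebra, hence contains
    [w']. *)
Lemma cond_expectation_atom n w w' : emb n w = emb n w' -> emb n.+1 w = emb n.+1 w' ->
  C n.+1 w = C n.+1 w'.
Proof.
move=> e1 e2; have SA := (hC n).1 _ (emeasurable_set1 (C n.+1 w)).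
by have /= -> := g_sigma_preimageU_atom SA e1 e2 erefl.
Qed.

Let atom n y y' := [set w | emb n w = y /\ emb n.+1 w = y'].

Let atom_sigma n y y' : VD y -> VD y' ->
  g_sigma_preimageU (emb n) (emb n.+1) (atom n y y').
Proof.
move=> Vy Vy'.
have sI : setI_closed (g_sigma_preimageU (emb n) (emb n.+1)).
  exact: (@measurableI _ (g_sigma_algebraType _)).
by apply: (sI (emb n @^-1` [set y]) (emb n.+1 @^-1` [set y']));
  apply: sub_sigma_algebra; [left|right]; (eexists; [|rewrite setTI; reflexivity]);
  exact: m1.
Qed.

(* [C n.+1] is constant on the atoms of its sigma-algebra. *)
Let integral_atom n y y' w : VD y -> VD y' -> atom n y y' w ->
  C n.+1 w * P x (atom n y y') =
  \int[P x]_(v in atom n y y') (tau n.+1 v - tau n v).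
Proof.
move=> Vy Vy' [wy wy']; have sA := @atom_sigma n _ _ Vy Vy'.
rewrite -(hC n).2// (eq_integral (cst (C n.+1 w))).
  rewrite integral_cst//.
  exact: (g_sigma_preimageU_measurable (memb n) (memb n.+1)).
move=> v; rewrite inE => -[vy vy']; apply: cond_expectation_atom.
  by rewrite vy.
by rewrite vy'.
Qed.

(** Almost surely [X] starts at [x] and [tau 1 = 0], so the atom over the pair of positions [x], [x]
    has mass 1 and the duration vanishes on it. *)
Lemma cond_expectation_first : {ae P x, forall w, C 1 w = 0}.
Proof.
have sA := @atom_sigma 0 _ _ hx hx.
have PA : P x (atom 0 x x) = 1.
  rewrite -(probability_setT (P x)); apply: ae_measure_eq => //.
    exact: (g_sigma_preimageU_measurable (memb 0) (memb 1)).
  apply: filterS (ae_start hX hVD hx) => w Xx; split => // _.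
  by have [] := embedding_start hx Xx.
apply: filterS (ae_start hX hVD hx) => w Xx.
have [_ e1] := embedding_start hx Xx.
have := @integral_atom 0 _ _ w hx hx (conj Xx e1).
rewrite PA mule1 => ->; apply: integral0_eq => v [Xv _].
by have [+ _] := embedding_start hx Xv; rewrite -/tau => ->; rewrite sube0.
Qed.

Hypothesis tau_fin : {ae P x, forall w, forall k, tau k w < +oo}.

(** A null atom is its own exceptional set. On any other atom, the constant value of [C n.+2] is the
    integral of the duration divided by the mass; [step_time] and [step_prob] make this quotient the
    transition time. *)
Let atom_time n y y' : VD y -> VD y' ->
  {ae P x, forall w, emb n.+1 w = y -> emb n.+2 w = y' ->
    C n.+2 w = transition_time P X U y y'}.
Proof.
move=> Vy Vy'; have mA : measurable (atom n.+1 y y').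
  by apply: (g_sigma_preimageU_measurable (memb n.+1) (memb n.+2)); exact: atom_sigma.
have [A0|Apos] := eqVneq (P x (atom n.+1 y y')) 0.
  exists (atom n.+1 y y'); split => // w /= h; apply: contrapT => nA.
  by apply: h => ? ?; case: nA.
apply: aeW => w wy wy'.
pose A := [set w | tau n.+1 w < +oo /\ [set y] (emb n.+1 w)].
pose B := A `&` [set w | tau n.+2 w < +oo /\ emb n.+2 w = y'].
have sA : stopped_events F (tau n.+1) A.
  exact: (at_time_stopped hF aX (@cX) (stau n.+1) (cl1 Vy)).
have mB : measurable B.
  apply: measurableI; first by case: sA.
  by case: (at_time_stopped hF aX (@cX) (stau n.+2) (cl1 Vy')).
(* At an infinite embedding time the position is the junk value [X 0], so the two events agree only
   where all times are finite. *)
have AB : {ae P x, forall w, atom n.+1 y y' w <-> B w}.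
  apply: filterS tau_fin => v vfin; split => [[vy vy']|[[_ vy] [_ vy']]] //.
have Ay v : A v -> tau n.+1 v < +oo /\ emb n.+1 v = y by [].
have PA : P x (atom n.+1 y y') = P x A * transition_prob P X U y y'.
  by rewrite (ae_measure_eq mA mB AB); exact: (step_prob hX hVD hU hx).
have := integral_atom Vy Vy' (conj wy wy').
rewrite (ae_integral_eq mA mB AB); last exact: emeasurable_funB.
rewrite (step_time hX hVD hU hx x sA Vy Vy' Ay).
rewrite /transition_time; set I := \int[_]_(_ in _) _.
move: Apos; rewrite PA.
have /fineK <- : P x A \is a fin_num by rewrite fin_num_measure//; case: sA.
have /fineK <- : transition_prob P X U y y' \is a fin_num.
  rewrite fin_num_measure// -(path_from0_exit hX).
  rewrite -[X in measurable X]setTI.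
  exact: (path_from0_measurable hX measurableT (exit_event_measurable hVD hU Vy Vy')).
set a := fine (P x A); set p := fine (transition_prob _ _ _ _ _) => Apos CE.
have [a0 p0] : (a != 0%R) /\ (p != 0%R).
  by split; apply: contraNneq Apos => ->; rewrite ?mul0e ?mule0.
(* Multiplying by [a * p / (a * p)] brings in the mass of the atom, so that [CE] applies and the
   factor [a] cancels. *)
rewrite -[LHS]mule1 -[X in _ * X]/(1%R%:E) -(@divff _ (a * p)%R); last first.
  by rewrite mulf_neq0.
rewrite EFinM muleA EFinM CE invfM EFinM muleACA -EFinM divff//.
by rewrite mul1e.
Qed.

Lemma cond_expectation_next (g : nat -> gpoint G) (f : gpoint G -> nat) :
  (forall m, VD (g m)) -> (forall y, VD y -> g (f y) = y) ->
  {ae P x, forall w, forall n,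
    C n.+2 w = transition_time P X U (emb n.+1 w) (emb n.+2 w)}.
Proof.
move=> Vg gf; apply: ae_foralln => n.
have : {ae P x, forall w, forall m m', emb n.+1 w = g m -> emb n.+2 w = g m' ->
    C n.+2 w = transition_time P X U (g m) (g m')}.
  by apply: ae_foralln => m; apply: ae_foralln => m'; exact: atom_time.
apply: filterS2 tau_fin => w wfin h.
have V1 := embedding_time_vertex hX hVD (wfin n.+1).
have V2 := embedding_time_vertex hX hVD (wfin n.+2).
have := h (f (emb n.+1 w)) (f (emb n.+2 w)).
by rewrite !gf//; apply.
Qed.

End conditional_times.

(** * The embedded process *)

Section embedded_process.
Context {R : realType} {G : metric_graph R} {d : measure_display}
  {Omega : measurableType d}.
Variables (P : gpoint G -> probability Omega R) (X : R -> Omega -> gpoint G)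
  (VD : set (gpoint G)) (U : gpoint G -> set (gpoint G)).
Variable C : nat -> Omega -> \bar R.

Let S k w := \sum_(1 <= n < k.+1) C n w.

Lemma embedding_index_some t w k : t%:E < S k w ->
  (forall j, t%:E < S j w -> (k <= j)%N) -> embedding_index C t w = Some k.
Proof.
move=> tS kmin; rewrite /embedding_index.
case: xgetP => [r _ [k' [-> tS' k'min]]|/(_ (Some k))[]]; last by exists k.
by congr Some; apply: anti_leq; rewrite kmin// k'min.
Qed.

Lemma embedding_index_none t w : (forall k, S k w <= t%:E) ->
  embedding_index C t w = None.
Proof.
move=> St; rewrite /embedding_index; case: xgetP => // r _ [k [_ + _]].
by rewrite ltNge St.
Qed.

Lemma embedding_index_cases t w :
  (exists k, [/\ t%:E < S k w, forall j, t%:E < S j w -> (k <= j)%N &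
     embedding_index C t w = Some k]) \/
  (forall k, S k w <= t%:E) /\ embedding_index C t w = None.
Proof.
have [ex|nex] := pselect (exists k, t%:E < S k w).
  left; have [k tS kmin] := ex_minnP ex.
  by exists k; split => //; exact: embedding_index_some.
right; have St k : S k w <= t%:E by rewrite leNgt; apply/negP => tS; apply: nex; exists k.
by split => //; exact: embedding_index_none.
Qed.

Lemma embedded_process_measurable z t :
  (forall k, measurable_fun setT (C k.+1)) ->
  (forall k, measurable_fun setT (embedded X VD k)) ->
  measurable_fun setT (embedded_process X VD z C t : Omega -> borel G).
Proof.
move=> mC memb _ B mB; rewrite setTI.
have mS k : measurable [set w | t%:E < S k w].
  rewrite -[X in measurable X]setTI; apply: emeasurable_fun_o_infty => //.
  rewrite (_ : S k = fun w => \sum_(0 <= n < k) C n.+1 w); first exact: emeasurable_sum.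
  by apply/funext => w; rewrite /S big_add1.
pose I k := [set w | embedding_index C t w = Some k].
have IE k : I k = [set w | t%:E < S k w] `&`
    \bigcap_j ([set _ | (k <= j)%N] `|` ~` [set w | t%:E < S j w]).
  apply/seteqP; split => w; rewrite /I /mkset.
    have [[k' [tS k'min ->]]|[_ ->//]] := embedding_index_cases t w.
    move=> [<-]; split => // j _; have [tSj|] := pselect (t%:E < S j w).
      by left; exact: k'min.
    by right.
  move=> [tS h]; apply: embedding_index_some => // j tSj.
  by have [] := h j Logic.I.
have mI k : measurable (I k).
  rewrite IE; apply: measurableI => //; apply: bigcapT_measurable => j.
  by apply: measurableU; [exact: measurable_prop|exact: measurableC].
rewrite (_ : _ @^-1` _ = \bigcup_k (I k `&` embedded X VD k @^-1` B) `|`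
   (~` (\bigcup_k I k) `&` [set _ | B z])).
  apply: measurableU.
    apply: bigcupT_measurable => k; apply: measurableI => //.
    by rewrite -[X in measurable X]setTI; exact: memb.
  apply: measurableI; last exact: measurable_prop.
  by apply: measurableC; exact: bigcupT_measurable.
apply/seteqP; split => w; rewrite /preimage /mkset /embedded_process.
  case E : (embedding_index C t w) => [k|] Bw; first by left; exists k.
  by right; split => // -[k _]; rewrite /I /mkset E.
move=> [[k _ [-> //]]|[]]; case E : (embedding_index C t w) => [k|//] [].
by exists k.
Qed.

(** Since [C 1 w = 0], the partial sum of order [k.+1] is the jump time of order [k] of the chain
    read from [emb 1] on. *)
Lemma embedded_process_stmca z t w : (0 <= t)%R -> C 1 w = 0 ->
  (forall n, C n.+2 w =
     transition_time P X U (embedded X VD n.+1 w) (embedded X VD n.+2 w)) ->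
  embedded_process X VD z C t w =
  stmca P X U (fun k => embedded X VD k.+1) z t w.
Proof.
move=> t0 C1 CS; pose J := jump_time P X U (fun k => embedded X VD k.+1).
have SJ k : S k.+1 w = J k w.
  elim: k => [|k ih]; first by rewrite /S big_nat1 C1 /J /jump_time big_geq.
  by rewrite /S big_nat_recr//= -/(S k.+1 w) ih CS /J /jump_time big_nat_recr.
have S0 : S 0 w = 0 by rewrite /S big_geq.
have [[k Jk]|nJ] := pselect (exists k, J k w <= t%:E < J k.+1 w).
  (* The first partial sum above [t] is [S k.+2], equal to [J k.+1]; both sides are then
     [embedded X VD k.+2]. *)
  rewrite (stmca_jump z Jk) /embedded_process (@embedding_index_some _ _ k.+2)//.
    by rewrite SJ; case/andP: Jk.
  move=> [|j]; first by rewrite S0 lte_fin ltNge t0.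
  rewrite SJ ltnS => tJ; rewrite ltnNge; apply/negP => jk; move: tJ.
  rewrite ltNge => /negP; apply; case/andP: Jk => Jt _.
  by apply: le_trans Jt; exact: jump_time_le.
(* With no interval containing [t], all jump times stay at or below [t], and both processes take the
   value [z]. *)
have Jt k : J k w <= t%:E.
  elim: k => [|k ih]; first by rewrite -SJ /S big_nat1 C1 lee_fin.
  by rewrite leNgt; apply/negP => tJ; apply: nJ; exists k; rewrite ih tJ.
rewrite stmca_nojump; last by move=> k Jk; apply: nJ; exists k.
by rewrite /embedded_process embedding_index_none// => -[|k]; rewrite ?S0 ?lee_fin ?SJ.
Qed.

End embedded_process.

(** The start [x] is taken in [VD], each [C n.+1] is an arbitrary version of the conditional
    expectation, and [z] is the common value of both processes once their clocks are exhausted. *)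
Theorem proposition2p13 (R : realType) (G : metric_graph R)
  (D : diffusion_data G)
  (d : measure_display) (Omega : measurableType d)
  (F : R -> set (set Omega)) (P : gpoint G -> probability Omega R)
  (X : R -> Omega -> gpoint G) (hX : general_diffusion D F P X)
  (VD : set (gpoint G)) (hVD : subdivision VD) (hcov : covering D VD)
  (U : gpoint G -> set (gpoint G)) (hU : cells_of VD U)
  (x : gpoint G) (hx : VD x)
  (d' : measure_display) (Omega' : measurableType d')
  (Q : probability Omega' R) (Y : nat -> Omega' -> gpoint G)
  (hY : stmca_chain P X VD U Q Y x)
  (C : nat -> Omega -> \bar R)
  (hC : forall n : nat,
    cond_expectation (P x)
      (g_sigma_preimageU (embedded X VD n) (embedded X VD n.+1))
      (fun w => embedding_time X VD n.+1 w - embedding_time X VD n w)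
      (C n.+1))
  (z : gpoint G) :
  same_law (P x) (embedded_process X VD z C) Q (stmca P X U Y z).
Proof.
have [g [f [Vg gf fx]]] := subdivision_enum hVD hx.
have [mY VY _ _] := hY.
have memb := embedded_measurable hX hVD hx.
have mC := cond_expectation_measurable hX hVD hx hC.
have tau_fin := embedding_times_finite hX hVD hU hx hY Vg gf fx.
have C1 := cond_expectation_first hX hVD hx hC.
have CS := cond_expectation_next hX hVD hU hx hC tau_fin Vg gf.
have mZ1 t : measurable_fun setT (embedded_process X VD z C t : Omega -> borel G).
  exact: embedded_process_measurable.
have mZ2 t : measurable_fun setT (stmca P X U Y z t : Omega' -> borel G).
  exact: (stmca_measurable P X U hVD hx mY VY).
split => // n t B t0 mB.
(* Both chains are coded in the same sequence space; the index [i.+1] discards the position at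
   [tau 0]. *)
pose N1 w : seq_space g := fun i => f (embedded X VD i.+1 w).
pose N2 w : seq_space g := fun i => f (Y i w).
pose Y0 i (s : seq_space g) := g (s i).
have mY0 i : measurable_fun setT (Y0 i : seq_space g -> borel G).
  exact: term_measurable.
have VY0 i s : VD (Y0 i s) by exact: Vg.
have cylinderE d0 (T : measurableType d0) (Z : R -> T -> gpoint G) :
    (forall t, measurable_fun setT (Z t : T -> borel G)) -> measurable (cylinder Z t B).
  move=> mZ; rewrite (_ : cylinder _ _ _ = \bigcap_(i : 'I_n) (Z (t i) @^-1` (B i))).
    apply: fin_bigcap_measurable => // i _; rewrite -[X in measurable X]setTI; exact: mZ.
  by apply/seteqP; split => w /= h i; [move=> _; exact: h|exact: h].
(* One event on sequence space of which both cylinders are preimages, the first up to a null set. *)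
pose E := cylinder (stmca P X U Y0 z) t B.
have mE : measurable E.
  by apply: cylinderE => u; exact: (stmca_measurable P X U hVD hx mY0 VY0).
have code d0 (T : measurableType d0) (Z : nat -> T -> gpoint G) :
    (forall i m, measurable [set w | f (Z i w) = m]) ->
    measurable_fun setT (fun w => (fun i => f (Z i w)) : seq_space g).
  move=> mZ; apply: seq_map_measurable => k a.
  apply: (@measurable_prefix _ _ (fun i => [set w | g (f (Z i w)) = g (a i)])) => i.
  rewrite (_ : mkset _ = \bigcup_m ([set _ | g m = g (a i)] `&` [set w | f (Z i w) = m])).
    by apply: bigcupT_measurable => m; apply: measurableI => //; exact: measurable_prop.
  apply/seteqP; split => w /=; first by move=> h; exists (f (Z i w)).
  by move=> [m _ [/= gm fm]]; rewrite fm gm.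
have mN1 : measurable_fun setT N1.
  apply: code => i m; exact: (embedded_code_measurable hX hVD hx fx).
have mN2 : measurable_fun setT N2.
  apply: code => i m; exact: (chain_code_measurable hVD hY Vg gf).
(* By [visits_law] the codes have the same law on cylinders; [transfer_measure], used with the full
   set and factor 1, extends this to [E]. *)
have N12 A : seq_cylinders g A ->
    P x (setT `&` N1 @^-1` A) = (1%:nng : {nonneg R})%:num%:E * Q (N2 @^-1` A).
  rewrite setTI mul1e => -[->|->|[k [a ->]]].
  - by rewrite !preimage_setT !probability_setT.
  - by rewrite !preimage_set0 !measure0.
  transitivity (P x (visits X VD (g \o a) k)).
    apply: ae_measure_eq.
    - rewrite -[X in measurable X]setTI; apply: mN1 => //.
      by apply: sub_sigma_algebra; apply: Or33; exists k, a.
    - by case: (visits_stopped hX hVD hx k (fun i => Vg (a i))).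
    apply: filterS tau_fin => w wfin.
    have gfE i : g (N1 w i) = embedded X VD i.+1 w.
      by rewrite gf//; exact: (embedding_time_vertex hX hVD).
    split => [h|[_ h] i ik]; last by rewrite gfE h.
    by split => // i ik; rewrite -gfE h.
  rewrite (visits_law hX hVD hU hx hY k (fun i => Vg (a i))); congr (Q _).
  have gfY i w : g (N2 w i) = Y i w by rewrite gf.
  apply/seteqP; split => w /= h i ik; first by rewrite gfY h.
  by rewrite -gfY h.
(* Almost surely the embedding times are finite and the versions [C] take the values of the STMCA
   clock, so the embedded process is the STMCA functional of [N1]. *)
have -> : P x (cylinder (embedded_process X VD z C) t B) = P x (N1 @^-1` E).
  apply: ae_measure_eq.
  - exact: cylinderE.
  - by rewrite -[X in measurable X]setTI; exact: mN1.
  apply: filterS3 tau_fin C1 CS => w wfin w1 wS.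
  suff ZE u : (0 <= u)%R -> embedded_process X VD z C u w = stmca P X U Y0 z u (N1 w).
    by split => h i; have := h i; rewrite ZE.
  move=> u0; rewrite (embedded_process_stmca z u0 w1 wS); apply: stmca_ext => k.
  by rewrite /Y0 gf//; exact: (embedding_time_vertex hX hVD).
have -> : cylinder (stmca P X U Y z) t B = N2 @^-1` E.
  have ZE u w : stmca P X U Y z u w = stmca P X U Y0 z u (N2 w).
    by apply: stmca_ext => k; rewrite /Y0 gf.
  by apply/seteqP; split => w h i; have := h i; rewrite ZE.
have := transfer_measure mN1 mN2 measurableT _ _ (@seq_cylindersI _ _ g) _ N12 mE.
rewrite setTI mul1e; apply => //; last exact: Or31.
by rewrite ltey_eq fin_num_measure.
Qed.
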